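(* Let $G=(V,E)$ be a unit disk graph admitting a liar's dominating set. The following algorithm runs in $O(|V|+|E|)$ time and returns a liar's dominating set $D$ with $|D|\le 7.31\,|D^*|$, where $D^*$ is a minimum liar's dominating set of $G$. Algorithm: start with $D=\emptyset$ and $W=V$. For $i=1,2,3$: if $W\neq\emptyset$, let $I_i$ be a maximal independent set of the subgraph of $G$ induced by $W$, set $D\leftarrow D\cup I_i$ and $W\leftarrow W\setminus I_i$ (if $W=\emptyset$, $I_i=\emptyset$). Then, for every $u\in I_1$: if $N_G(u)\cap(I_2\cup I_3)=\emptyset$, choose a vertex $v\in N_G(u)$ and add $v$ to $D$; else if $N_G(u)\cap(I_2\cup I_3)=\{v\}$ consists of exactly one vertex $v$, choose a neighbor $w$ of $v$ in $G$ with $w\neq u$ and add $w$ to $D$. Return $D$.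
   Context: A unit disk graph (UDG) $G=(V,E)$ is the graph whose vertices correspond to points in the plane, two distinct vertices being adjacent if and only if the Euclidean distance between the corresponding points is at most $1$. $N_G(v)$ is the open neighborhood of $v$ in $G$ and $N_G[v]=N_G(v)\cup\{v\}$. A liar's dominating set (LDS) of $G$ is a set $D\subseteq V$ such that (i) $|N_G[v]\cap D|\ge 2$ for every $v\in V$, and (ii) $|(N_G[u]\cup N_G[v])\cap D|\ge 3$ for every pair of distinct $u,v\in V$. A minimum liar's dominating set is an LDS of minimum cardinality.
   Formalization: A neighbor w≠u of v may not exist for some choices of the I_i, so the algorithm can get stuck; the guarantee on D is stated for every run that completes, and the O(|V|+|E|) bound for an implementation whose choices always let it complete. *)

(* Defs.v *)
From HB Require Import structures.
From mathcomp Require Import all_boot all_order all_algebra.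
From mathcomp Require Import reals.

Set Implicit Arguments.
Unset Strict Implicit.
Unset Printing Implicit Defensive.

Import Order.TTheory GRing.Theory Num.Theory.

(* The distance is spelled out because the library norms on R * R and on
   row vectors are sup norms. *)
Definition edist (R : realType) (p q : R * R) : R :=
  Num.sqrt ((p.1 - q.1) ^+ 2 + (p.2 - q.2) ^+ 2)%R.

(* Distinct vertices may be placed at the same point (and are then
   adjacent). *)
Definition unit_disk_graph (R : realType) (V : finType) (e : rel V) : Prop :=
  exists pos : V -> R * R,
    forall u v, e u v = (u != v) && (edist (pos u) (pos v) <= 1)%R.

Section Graph.
Variables (V : finType) (e : rel V).

Definition edges : {set {set V}} :=
  [set [set x.1; x.2] | x : V * V & e x.1 x.2].

Definition nbr (v : V) : {set V} := [set w | e v w].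
Definition cnbr (v : V) : {set V} := v |: nbr v.

Definition liars_dominating (D : {set V}) : Prop :=
  (forall v, 2 <= #|cnbr v :&: D|) /\
  (forall u v, u != v -> 3 <= #|(cnbr u :|: cnbr v) :&: D|).

Definition minimum_liars_dominating (D : {set V}) : Prop :=
  liars_dominating D /\
  forall D', liars_dominating D' -> #|D| <= #|D'|.

Definition independent (I : {set V}) : bool :=
  [forall u in I, forall v in I, ~~ e u v].

Definition maximal_independent_in (W I : {set V}) : bool :=
  maxset (fun J : {set V} => (J \subset W) && independent J) I.

(* The algorithm is nondeterministic: each of the relations below holds for
   every way of resolving its choices. *)

Definition select_round (W I : {set V}) : Prop :=
  if W == set0 then I = set0 else maximal_independent_in W I.

(* [augment I2 I3 u D D']: the body of the loop, executed for the vertex u,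
   may turn D into D'.  No D' exists when the vertex to be chosen does not;
   this happens exactly when nbr u is empty, or when the only element v of
   nbr u :&: (I2 :|: I3) has no neighbour besides u. *)
Inductive augment (I2 I3 : {set V}) (u : V) (D : {set V}) : {set V} -> Prop :=
| Augment_none v of
    nbr u :&: (I2 :|: I3) = set0 & v \in nbr u : augment I2 I3 u D (v |: D)
| Augment_one v w of
    nbr u :&: (I2 :|: I3) = [set v] & w \in nbr v & w != u :
    augment I2 I3 u D (w |: D)
| Augment_many of
    1 < #|nbr u :&: (I2 :|: I3)| : augment I2 I3 u D D.

Fixpoint augment_all (I2 I3 : {set V}) (us : seq V) (D D' : {set V}) : Prop :=
  if us is u :: us' then
    exists2 D1, augment I2 I3 u D D1 & augment_all I2 I3 us' D1 D'
  else D' = D.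

(* A completed run, with intermediate sets I1, I2, I3 and returned set D; the
   loop visits the vertices of I1 in an arbitrary order us. *)
Definition algorithm_run (I1 I2 I3 D : {set V}) : Prop :=
  [/\ select_round setT I1,
      select_round (setT :\: I1) I2,
      select_round (setT :\: I1 :\: I2) I3 &
      exists2 us, perm_eq us (enum I1) &
        augment_all I2 I3 us (I1 :|: I2 :|: I3) D].

End Graph.

(* Time is measured on a structured random access machine: finitely many
   registers and arrays of natural numbers, every operation and every memory
   access taking one unit of time.  The only arithmetic operation is the
   successor (there is no addition or multiplication), so after t steps all
   values are at most t plus the largest constant or input value, and unit
   cost cannot hide arithmetic on long numbers. *)
Inductive expr : Type :=
| Cst of nat
| Reg of nat
| Get of nat & expr
| Suc of expr
| Eqb of expr & expr
| Ltb of expr & expr.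

Inductive cmd : Type :=
| Assign of nat & expr
| Store of nat & expr & expr
| Seq of cmd & cmd
| If of expr & cmd & cmd
| While of expr & cmd.

Record state : Type := State {
  reg : nat -> nat;
  arr : nat -> nat -> nat }.

Definition upd (T : Type) (f : nat -> T) (i : nat) (x : T) : nat -> T :=
  fun j => if j == i then x else f j.

Definition set_reg (s : state) (x k : nat) : state :=
  State (upd (reg s) x k) (arr s).

Definition set_arr (s : state) (a i k : nat) : state :=
  State (reg s) (upd (arr s) a (upd (arr s a) i k)).

Fixpoint eval (s : state) (x : expr) : nat :=
  match x with
  | Cst k => k
  | Reg r => reg s r
  | Get a y => arr s a (eval s y)
  | Suc y => (eval s y).+1
  | Eqb y z => eval s y == eval s z
  | Ltb y z => eval s y < eval s z
  end.

Fixpoint ecost (x : expr) : nat :=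
  match x with
  | Cst _ | Reg _ => 1
  | Get _ y | Suc y => (ecost y).+1
  | Eqb y z | Ltb y z => (ecost y + ecost z).+1
  end.

(* [exec c s t s']: from s, the command c halts in state s' after exactly t
   units of time. *)
Inductive exec : cmd -> state -> nat -> state -> Prop :=
| Exec_assign s r x :
    exec (Assign r x) s (ecost x).+1 (set_reg s r (eval s x))
| Exec_store s a x y :
    exec (Store a x y) s (ecost x + ecost y).+1
      (set_arr s a (eval s x) (eval s y))
| Exec_seq c1 c2 s s1 s2 t1 t2 of
    exec c1 s t1 s1 & exec c2 s1 t2 s2 : exec (Seq c1 c2) s (t1 + t2) s2
| Exec_if_true x c1 c2 s s1 t1 of
    eval s x != 0 & exec c1 s t1 s1 :
    exec (If x c1 c2) s (ecost x + t1).+1 s1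
| Exec_if_false x c1 c2 s s1 t1 of
    eval s x = 0 & exec c2 s t1 s1 :
    exec (If x c1 c2) s (ecost x + t1).+1 s1
| Exec_while_true x c s s1 s2 t1 t2 of
    eval s x != 0 & exec c s t1 s1 & exec (While x c) s1 t2 s2 :
    exec (While x c) s (ecost x + t1 + t2).+1 s2
| Exec_while_false x c s of
    eval s x = 0 : exec (While x c) s (ecost x).+1 s.

Section Encoding.
Variables (V : finType) (e : rel V).

Definition adjacency_lists (vs : seq V) (adj : V -> seq V) : Prop :=
  perm_eq vs (enum V) /\ forall v, perm_eq (adj v) (enum (nbr e v)).

(* A vertex is represented by its position in vs.  Register 0 holds |V|, the
   list of the i-th vertex occupies the cells of array 1 from position
   arr 0 i (included) to position arr 0 i.+1 (excluded), and the rest of the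
   memory is zero. *)
Definition input_state (vs : seq V) (adj : V -> seq V) : state :=
  State
    (fun r => if r == 0 then size vs else 0)
    (fun a i =>
       if a == 0 then sumn [seq size (adj v) | v <- take i vs]
       else if a == 1 then
         nth 0 (flatten [seq [seq index w vs | w <- adj v] | v <- vs]) i
       else 0).

Definition marked (vs : seq V) (s : state) (a : nat) : {set V} :=
  [set v | arr s a (index v vs) != 0].

(* [c] carries out the algorithm on the graph within time T: it leaves the
   indicator functions of I1, I2, I3 and D of a completed run in arrays
   2, 3, 4 and 5, whatever the adjacency lists presenting the graph. *)
Definition implements_within (c : cmd) (T : nat) : Prop :=
  forall (vs : seq V) (adj : V -> seq V), adjacency_lists vs adj ->
  exists t s,
    [/\ exec c (input_state vs adj) t s, t <= T &
        algorithm_run e (marked vs s 2) (marked vs s 3)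
                        (marked vs s 4) (marked vs s 5)].

End Encoding.

(* Main.v *)
Require Import Defs.
From mathcomp Require Import all_boot all_order all_algebra.
From mathcomp Require Import reals ring lra zify.

(** Ratio.  Let P be the set of the u in I1 with at most one neighbour in
    I2 :|: I3; at most #|P| vertices are added to I1 :|: I2 :|: I3.  Each u in P
    has no neighbour in I2 (say u is in P2) or none in I3 (u is in P3), so
    I1, I2 :|: P2 and I3 :|: P3 are three independent sets without a common
    vertex whose sizes add up to a bound for #|D|.  Every element s of these
    sets splits a unit charge among the vertices of D* in N[s]: equally,
    except that among exactly three vertices the one opposite to a longest side
    of their triangle receives 0.38 and the others 0.31.  Each d in D* receives
    at most 7.31.  Indeed N[d] contains at most 5 elements of an independent
    set, so d receives at most 15 charges, each at most 1/2, and only the case of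
    exactly 15 is not immediate.  Then each independent set meets the lens
    N[d] :&: N[m] for every m in D* adjacent to d (otherwise m could be added to
    it inside N[d]).  Vertices with only two vertices of D* in their closed
    neighbourhoods are determined by this pair, hence some of the charges are at
    most 0.38; if there is just one such charge, then a 60-degree argument shows
    that d is not opposite to a longest side, so this charge is at most 0.31, and
    14 / 2 + 0.31 = 7.31.

    Running time.  If the greedy choice of I1 starts with the vertices of degree
    1, all of them enter I1, and two entries of an adjacency list suffice to make
    each choice of the last loop. *)

Set Implicit Arguments.
Unset Strict Implicit.
Unset Printing Implicit Defensive.

Import Order.TTheory GRing.Theory Num.Theory.

(** * Angles in the plane *)

Section Plane.
Local Open Scope ring_scope.
Variable R : realType.
Implicit Types p q b : R * R.

Definition dot p q : R := p.1 * q.1 + p.2 * q.2.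
Definition len p : R := Num.sqrt (dot p p).

Lemma dot_ge0 p : 0 <= dot p p.
Proof. by rewrite /dot -!expr2 addr_ge0 ?sqr_ge0. Qed.

Lemma len_ge0 p : 0 <= len p.
Proof. exact: sqrtr_ge0. Qed.

Lemma sqr_len p : len p ^+ 2 = dot p p.
Proof. exact/sqr_sqrtr/dot_ge0. Qed.

Lemma edist_len p q : edist p q = len (p - q).
Proof. by rewrite /edist /len /dot -!expr2. Qed.

Lemma edistC p q : edist p q = edist q p.
Proof. by rewrite /edist -[p.1 - _]opprB -[p.2 - _]opprB !sqrrN. Qed.

Lemma edistxx p : edist p p = 0.
Proof. by rewrite /edist !subrr expr0n addr0 sqrtr0. Qed.

Lemma sqr_edist p q : edist p q ^+ 2 = len p ^+ 2 + len q ^+ 2 - 2 * dot p q.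
Proof. by rewrite edist_len !sqr_len /dot /=; ring. Qed.

Lemma edist_sub p q c : edist (p - c) (q - c) = edist p q.
Proof. by rewrite !edist_len opprB addrA subrK. Qed.

(** Compares the cosine with 1/2 without dividing by the lengths. A zero vector satisfies
    [angle_ge60] but never [angle_gt60]. *)
Definition angle_gt60 p q := 2 * dot p q < len p * len q.
Definition angle_ge60 p q := 2 * dot p q <= len p * len q.

Lemma angle_gt60_sym p q : angle_gt60 p q = angle_gt60 q p.
Proof. by rewrite /angle_gt60 mulrC [len _ * _]mulrC /dot ![_ * q.1]mulrC
  ![_ * q.2]mulrC mulrC. Qed.

(** If, say, [len p <= len q], an angle of at most 60 degrees would give [edist p q ^+ 2 <= len q ^+
    2 - len p * (len q - len p) <= 1]. *)
Lemma angle_gt60_far p q :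
  len p <= 1 -> len q <= 1 -> 1 < edist p q -> angle_gt60 p q.
Proof.
move=> p1 q1 d1; have p0 := len_ge0 p; have q0 := len_ge0 q.
have: 1 < edist p q ^+ 2 by rewrite exprn_egt1.
rewrite sqr_edist /angle_gt60.
have [pq|/ltW qp] := leP (len p) (len q).
  have := mulr_ge0 p0 (_ : 0 <= len q - len p); rewrite subr_ge0 => /(_ pq).
  have : len q ^+ 2 <= 1 by rewrite exprn_ile1.
  by lra.
have := mulr_ge0 q0 (_ : 0 <= len p - len q); rewrite subr_ge0 => /(_ qp).
have : len p ^+ 2 <= 1 by rewrite exprn_ile1.
by lra.
Qed.

Lemma angle_ge60_longest p q :
  len p <= edist p q -> len q <= edist p q -> angle_ge60 p q.
Proof.
move=> pd qd; have p0 := len_ge0 p; have q0 := len_ge0 q.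
rewrite /angle_ge60; have := sqr_edist p q.
have : len p ^+ 2 <= edist p q ^+ 2 by rewrite lerXn2r ?nnegrE ?(le_trans p0).
have : len q ^+ 2 <= edist p q ^+ 2 by rewrite lerXn2r ?nnegrE ?(le_trans q0).
have [pq|/ltW qp] := leP (len p) (len q).
  have := mulr_ge0 p0 (_ : 0 <= len q - len p); rewrite subr_ge0 => /(_ pq).
  by lra.
have := mulr_ge0 q0 (_ : 0 <= len p - len q); rewrite subr_ge0 => /(_ qp).
by lra.
Qed.

Definition sqrt3 : R := Num.sqrt 3.

Lemma sqrt3_gt0 : 0 < sqrt3. Proof. by rewrite sqrtr_gt0. Qed.
Lemma sqr_sqrt3 : sqrt3 ^+ 2 = 3. Proof. exact: sqr_sqrtr. Qed.

(* [a, c] and [a', c'] are coordinates along two unit vectors at 60 degrees. *)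
Lemma angle_lt60_cone p q (a c a' c' : R) :
  0 <= a -> 0 < c -> 0 <= a' -> 0 < c' ->
  3 * dot p p = a ^+ 2 + a * c + c ^+ 2 ->
  3 * dot q q = a' ^+ 2 + a' * c' + c' ^+ 2 ->
  6 * dot p q = 2 * a * a' + 2 * c * c' + a * c' + a' * c ->
  ~~ angle_ge60 p q.
Proof.
move=> a0 c0 a0' c0' pp qq pq; rewrite /angle_ge60 -ltNge.
have aa := mulr_ge0 a0 a0'; have cc := mulr_gt0 c0 c0'.
have ac := mulr_ge0 a0 (ltW c0'); have ca := mulr_ge0 a0' (ltW c0).
have ac1 := mulr_ge0 a0 (ltW c0); have ac2 := mulr_ge0 a0' (ltW c0').
have d0 : 0 <= 2 * dot p q by lra.
rewrite -ltr_sqr ?nnegrE ?mulr_ge0 ?len_ge0 //; last by lra.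
rewrite [X in X < _]exprMn !sqr_len.
suff: 9 * (dot p p * dot q q) < 9 * (2 * dot p q) ^+ 2 by lra.
have -> : 9 * (dot p p * dot q q) = (3 * dot p p) * (3 * dot q q) by ring.
have -> : 9 * (2 * dot p q) ^+ 2 = (6 * dot p q) ^+ 2 by ring.
rewrite pp qq pq -subr_gt0.
(* Expanding leaves only nonnegative products, among them the positive square of [c * c']. *)
have -> : (2 * a * a' + 2 * c * c' + a * c' + a' * c) ^+ 2 -
  (a ^+ 2 + a * c + c ^+ 2) * (a' ^+ 2 + a' * c' + c' ^+ 2) =
  3 * ((c * c') * (c * c') + (a * a') * (a * a') + 3 * ((a * a') * (c * c'))
  + (a * a') * (a * c') + (a * a') * (a' * c) + (c * c') * (a * c')
  + (c * c') * (a' * c)) by ring.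
rewrite pmulr_rgt0 //.
have := mulr_gt0 cc cc.
have := mulr_ge0 aa aa; have := mulr_ge0 aa (ltW cc); have := mulr_ge0 aa ac.
have := mulr_ge0 aa ca; have := mulr_ge0 ac (ltW cc); have := mulr_ge0 ca (ltW cc).
by lra.
Qed.

(* The vectors at more than 60 degrees from the first axis fall into the four
   sectors (60, 120], (120, 180], (180, 240] and (240, 300). *)
Definition sector q : 'I_4 :=
  inord (if 0 <= q.2 then nat_of_bool (sqrt3 * q.1 + q.2 < 0)%R
         else if sqrt3 * q.1 <= q.2 then 2%N else 3%N).

(** For [q.1 > 0], squaring the hypothesis gives [3 * q.1 ^+ 2 < q.2 ^+ 2], which [sqrt3] turns into
    a linear condition. *)
Lemma off_axis q : 2 * q.1 < len q ->
  (q.1 <= 0 \/ (sqrt3 * q.1 < q.2) \/ (sqrt3 * q.1 < - q.2)) /\ q != 0.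
Proof.
move=> h; split; last first.
  by apply/eqP=> q0; move: h; rewrite q0 /len /dot /= !mulr0 addr0 sqrtr0 ltxx.
have [|q1] := leP q.1 0; [by left | right].
have: (2 * q.1) ^+ 2 < len q ^+ 2.
  by rewrite ltr_sqr ?nnegrE ?len_ge0 // mulr_ge0 ?ltW.
rewrite sqr_len /dot -!expr2 exprMn => h2.
have h3 : (sqrt3 * q.1) ^+ 2 < `|q.2| ^+ 2.
  by rewrite real_normK ?num_real // exprMn sqr_sqrt3; lra.
have : sqrt3 * q.1 < `|q.2|.
  by rewrite -ltr_sqr ?nnegrE // mulr_ge0 // ltW // sqrt3_gt0.
by case: (ger0P q.2) => q2; [left | right].
Qed.

(** Each sector lies in a half-open cone between two unit vectors at 60 degrees. Scaled by [sqrt3],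
    the coordinates along these are integer combinations of [sqrt3 * p.1] and [p.2]. *)
Lemma same_sector p q : 2 * p.1 < len p -> 2 * q.1 < len q ->
  sector p = sector q -> ~~ angle_ge60 p q.
Proof.
move=> /off_axis[hp p0] /off_axis[hq q0] /(congr1 (@nat_of_ord 4)).
have r0 := sqrt3_gt0.
have nz (x : R * R) : x != 0 -> ~ (x.1 = 0 /\ x.2 = 0).
  move=> x0 [e1 e2]; case/eqP: x0; apply/eqP;
  by rewrite -[x == 0]/((x.1 == 0) && (x.2 == 0)) e1 e2 eqxx.
have neg (x : R * R) : x.1 <= 0 -> sqrt3 * x.1 <= 0 by move=> ?; rewrite pmulr_rle0.
have off (x : R * R) : x != 0 ->
    (x.1 <= 0 \/ (sqrt3 * x.1 < x.2) \/ (sqrt3 * x.1 < - x.2)) ->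
    (0 <= x.2 -> sqrt3 * x.1 < x.2) /\ (x.2 < 0 -> sqrt3 * x.1 < - x.2).
  move=> x0 [x1|hx]; last by split; case: hx; lra.
  have n1 := neg _ x1; split; last by lra.
  move=> x2; rewrite lt_neqAle (le_trans n1 x2) andbT; apply/eqP=> E.
  have E0 : sqrt3 * x.1 = 0 by lra.
  apply: (nz _ x0); split; last by lra.
  by move/eqP: E0; rewrite mulf_eq0 (gt_eqF r0) => /eqP.
have [p1 p2] := off _ p0 hp; have [q1 q2] := off _ q0 hq.
have s3 := sqr_sqrt3.
have E (x y : R * R) : 3 * dot x y = (sqrt3 * x.1) * (sqrt3 * y.1) + 3 * x.2 * y.2 :> R.
  by rewrite mulrACA -expr2 s3 /dot; ring.
have E6 (x y : R * R) : 6 * dot x y = 2 * ((sqrt3 * x.1) * (sqrt3 * y.1) + 3 * x.2 * y.2) :> R.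
  by rewrite -E; ring.
set u := sqrt3 * p.1 in p1 p2 *; set u' := sqrt3 * q.1 in q1 q2 *.
rewrite /sector !inordK; try by case: ifP => _; [case: (_ < _) | case: ifP].
rewrite -/u -/u'.
case: (leP 0 p.2) => hp2; case: (leP 0 q.2) => hq2.
- case: (ltP (u + p.2) 0) => sp; case: (ltP (u' + q.2) 0) => sq // _.
  (* The spanning directions are at 120 and 180 degrees here, then at 60 and 120, 180 and 240, 240
     and 300. *)
  + apply: (@angle_lt60_cone p q (2 * p.2) (- (u + p.2)) (2 * q.2) (- (u' + q.2)));
      rewrite ?E ?E6 -/u -/u'; try lra; try ring.
  + have := p1 hp2; have := q1 hq2 => ? ?.
    apply: (@angle_lt60_cone p q (p.2 + u) (p.2 - u) (q.2 + u') (q.2 - u'));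
      rewrite ?E ?E6 -/u -/u'; try lra; try ring.
- by case: ifP; case: (_ < 0).
- by case: ifP; case: (_ < 0).
case: (leP u p.2) => sp; case: (leP u' q.2) => sq // _.
  apply: (@angle_lt60_cone p q (p.2 - u) (- 2 * p.2) (q.2 - u') (- 2 * q.2));
      rewrite ?E ?E6 -/u -/u'; try lra; try ring.
have := p2 hp2; have := q2 hq2 => ? ?.
apply: (@angle_lt60_cone p q (- (p.2 + u)) (u - p.2) (- (q.2 + u')) (u' - q.2));
      rewrite ?E ?E6 -/u -/u'; try lra; try ring.
Qed.

(* Coordinates in the frame of [b], scaled by [len b]. *)
Definition frame b q : R * R := (dot b q, b.1 * q.2 - b.2 * q.1).

Lemma dot_frame b p q : dot (frame b p) (frame b q) = dot b b * dot p q.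
Proof. by rewrite /dot /=; rewrite /dot; ring. Qed.

Lemma len_frame b q : len (frame b q) = len b * len q.
Proof. by rewrite /len dot_frame sqrtrM // dot_ge0. Qed.

(** In the frame of [b] the vectors avoid the 60 degrees on either side of the first axis. Four
    sectors remain, and no two of the vectors share one. *)
Lemma card_angle60 (T : finType) (f : T -> R * R) b (S : {set T}) :
  {in S, forall s, angle_gt60 b (f s)} ->
  {in S &, forall s t, s != t -> angle_ge60 (f s) (f t)} ->
  (#|S| <= 4)%N.
Proof.
move=> hb hS; rewrite -[4%N]card_ord.
apply: (@leq_card_in _ _ (sector \o (fun s => frame b (f s)))).
move=> s t sS tS /= est; apply/eqP/negPn/negP=> nst.
have fs x : x \in S -> 2 * (frame b (f x)).1 < len (frame b (f x)).
  by move=> /hb; rewrite /angle_gt60 len_frame.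
have := same_sector (fs _ sS) (fs _ tS) est.
rewrite /angle_ge60 -ltNge !len_frame dot_frame => lt.
have := ler_wpM2l (dot_ge0 b) (hS _ _ sS tS nst).
rewrite -sqr_len in lt *; move: lt; rewrite /angle_ge60 expr2; lra.
Qed.

End Plane.

(** * Independent sets in unit disks *)

Lemma in_cnbr (V : finType) (e : rel V) u v :
  (v \in cnbr e u) = (v == u) || e u v.
Proof. by rewrite !inE. Qed.

Lemma independentP (V : finType) (e : rel V) (I : {set V}) :
  reflect {in I &, forall u v, ~~ e u v} (independent e I).
Proof.
apply: (iffP forall_inP) => [h u v uI vI | h u uI].
  exact: (forall_inP (h u uI)).
by apply/forall_inP => v vI; apply: h.
Qed.

Section UnitDisk.
Variables (R : realType) (V : finType) (e : rel V) (pos : V -> R * R).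
Hypothesis udg : forall u v, e u v = (u != v) && (edist (pos u) (pos v) <= 1)%R.

Lemma udg_irr u : e u u = false.
Proof. by rewrite udg eqxx. Qed.

Lemma udg_sym u v : e u v = e v u.
Proof. by rewrite !udg eq_sym edistC. Qed.

Lemma mem_disk u v : (v \in cnbr e u) = (edist (pos u) (pos v) <= 1)%R.
Proof. by rewrite in_cnbr udg eq_sym; case: eqP => //= ->; rewrite edistxx ler01. Qed.

Lemma cnbr_sym u v : (v \in cnbr e u) = (u \in cnbr e v).
Proof. by rewrite !mem_disk edistC. Qed.

Lemma cnbr_refl v : v \in cnbr e v.
Proof. by rewrite in_cnbr eqxx. Qed.

Lemma len_disk d v : v \in cnbr e d -> (len (pos v - pos d)%R <= 1)%R.
Proof. by rewrite cnbr_sym mem_disk edist_len. Qed.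

Lemma disk_gt60 d u v : u \in cnbr e d -> v \in cnbr e d ->
  v \notin cnbr e u -> angle_gt60 (pos u - pos d)%R (pos v - pos d)%R.
Proof.
move=> ud vd uv; apply: angle_gt60_far; rewrite ?len_disk // edist_sub.
by rewrite ltNge -mem_disk.
Qed.

Lemma independent_cnbr (K : {set V}) u v : independent e K ->
  u \in K -> v \in K -> (v \in cnbr e u) = (v == u).
Proof.
by move=> /independentP h uK vK; rewrite in_cnbr (negPf (h u v uK vK)) orbF.
Qed.

(** One vertex of [K] in the disk serves as the axis; the others are at more than 60 degrees from it
    and from each other. *)
Lemma card_independent_disk d (K : {set V}) :
  independent e K -> #|K :&: cnbr e d| <= 5.
Proof.
move=> iK; have [->|[b bK]] := set_0Vmem (K :&: cnbr e d); first by rewrite cards0.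
rewrite (cardsD1 b) bK add1n ltnS.
have mem s : s \in (K :&: cnbr e d) :\ b -> [/\ s != b, s \in K & s \in cnbr e d].
  by rewrite in_setD1 in_setI => /and3P.
move: bK; rewrite in_setI => /andP[bK bd].
apply: (@card_angle60 R V (fun s => pos s - pos d)%R (pos b - pos d)%R) => [s|s t].
  move=> /mem[sb sK sd]; apply: disk_gt60 => //.
  by rewrite (independent_cnbr iK).
move=> /mem[sb sK sd] /mem[tb tK td] st; apply/ltW/disk_gt60 => //.
by rewrite (independent_cnbr iK) // eq_sym.
Qed.

(** Otherwise [m] extends the five vertices to an independent set of six in the same disk. *)
Lemma full_disk_lens d m (K : {set V}) : independent e K ->
  #|K :&: cnbr e d| = 5 -> m \in cnbr e d ->
  exists2 s, s \in K :&: cnbr e d & s \in cnbr e m.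
Proof.
move=> iK K5 md.
case: (boolP [exists s in K :&: cnbr e d, s \in cnbr e m]) => [/exists_inP[s]|].
  by exists s.
rewrite negb_exists_in => /forall_inP far.
have mK : m \notin K :&: cnbr e d by apply/negP=> /far; rewrite cnbr_refl.
suff /(card_independent_disk d) : independent e (m |: (K :&: cnbr e d)).
  suff -> : (m |: (K :&: cnbr e d)) :&: cnbr e d = m |: (K :&: cnbr e d).
    by rewrite cardsU1 mK K5.
  by apply/setIidPl; rewrite subUset sub1set md subsetIr.
have far' s : s \in K :&: cnbr e d -> ~~ e m s.
  by move=> /far; rewrite in_cnbr negb_or => /andP[].
apply/independentP => u v; rewrite !in_setU1.
move=> /predU1P[->|uK] /predU1P[->|vK]; rewrite ?udg_irr //.
- exact: far'.
- by rewrite udg_sym far'.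
move: uK vK; rewrite !in_setI => /andP[uK _] /andP[vK _].
by move/independentP: iK; apply.
Qed.

(** If at most one of the five vertices were in the two lenses, one of the other four could serve as
    the axis, and three of them would form with [d1] and [d2] five directions where only four fit.
    The angle between [d1] and [d2] is large enough because it is opposite to a longest side. *)
Lemma full_disk_two_lenses d d1 d2 (K : {set V}) : independent e K ->
  #|K :&: cnbr e d| = 5 -> d1 \in cnbr e d -> d2 \in cnbr e d -> d1 != d2 ->
  (edist (pos d) (pos d1) <= edist (pos d1) (pos d2))%R ->
  (edist (pos d) (pos d2) <= edist (pos d1) (pos d2))%R ->
  1 < #|K :&: cnbr e d :&: (cnbr e d1 :|: cnbr e d2)|.
Proof.
move=> iK K5 d1d d2d d12 le1 le2; rewrite ltnNge; apply/negP => le.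
set S := K :&: cnbr e d in K5 le *; set U := cnbr e d1 :|: cnbr e d2 in le.
have : 3 < #|S :\: U| by move: (cardsID U S); rewrite K5; lia.
have [->|[b bS]] := set_0Vmem (S :\: U); first by rewrite cards0.
rewrite (cardsD1 b) bS add1n ltnS => c3.
have mem s : s \in S :\: U ->
    [/\ s \in K, s \in cnbr e d, s \notin cnbr e d1 & s \notin cnbr e d2].
  by rewrite in_setD in_setU negb_or in_setI => /andP[/andP[? ?] /andP[? ?]].
have gt s t : s \in S :\: U -> t \in S :\: U -> s != t ->
    angle_gt60 (pos s - pos d)%R (pos t - pos d)%R.
  move=> /mem[sK sd _ _] /mem[tK td _ _] st; apply: disk_gt60 => //.
  by rewrite (independent_cnbr iK) // eq_sym.
have gt1 s : s \in S :\: U -> angle_gt60 (pos d1 - pos d)%R (pos s - pos d)%R.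
  by move=> /mem[_ sd s1 _]; apply: disk_gt60.
have gt2 s : s \in S :\: U -> angle_gt60 (pos d2 - pos d)%R (pos s - pos d)%R.
  by move=> /mem[_ sd _ s2]; apply: disk_gt60.
have ge12 : angle_ge60 (pos d1 - pos d)%R (pos d2 - pos d)%R.
  by apply: angle_ge60_longest; rewrite edist_sub -edist_len edistC.
have nU x : x \in U -> x \notin (S :\: U) :\ b by move=> xU; rewrite in_setD1 in_setD xU andbF.
set T := d1 |: (d2 |: (S :\: U) :\ b).
have : #|T| <= 4.
  apply: (@card_angle60 R V (fun s => pos s - pos d)%R (pos b - pos d)%R).
    move=> s; rewrite !in_setU1 => /or3P[/eqP->|/eqP->|].
    - by rewrite angle_gt60_sym gt1.
    - by rewrite angle_gt60_sym gt2.
    by rewrite in_setD1 => /andP[sb sS]; apply: gt; rewrite // eq_sym.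
  have sym u v : angle_ge60 u v = angle_ge60 v u :> bool.
    by rewrite /angle_ge60 /dot mulrC [(len _ * _)%R]mulrC ![(_ * v.1)%R]mulrC
      ![(_ * v.2)%R]mulrC mulrC.
  move=> s t; rewrite !in_setU1 => /or3P[/eqP->|/eqP->|sS] /or3P[/eqP->|/eqP->|tS];
    rewrite ?eqxx // => st.
  - by apply/ltW/gt1; case/setD1P: tS.
  - by rewrite sym.
  - by apply/ltW/gt2; case/setD1P: tS.
  - by rewrite sym; apply/ltW/gt1; case/setD1P: sS.
  - by rewrite sym; apply/ltW/gt2; case/setD1P: sS.
  by case/setD1P: sS; case/setD1P: tS => _ tS _ sS; apply/ltW/gt.
have d1U : d1 \in U by rewrite in_setU cnbr_refl.
have d2U : d2 \in U by rewrite in_setU cnbr_refl orbT.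
rewrite !cardsU1 in_setU1 negb_or d12 (nU _ d1U) (nU _ d2U).
by move: c3; lia.
Qed.

End UnitDisk.

(** * The charging argument *)

Section Charging.
Variables (R : realType) (V : finType) (e : rel V) (pos : V -> R * R).
Hypothesis udg : forall u v, e u v = (u != v) && (edist (pos u) (pos v) <= 1)%R.
Variable Dstar : {set V}.
Hypothesis lds : liars_dominating e Dstar.

Definition cover (s : V) : {set V} := cnbr e s :&: Dstar.

Definition apex (C : {set V}) (d : V) : Prop := exists d1 d2,
  [/\ C = [set d; d1; d2], d1 != d2, d \notin [set d1; d2],
      (edist (pos d) (pos d1) <= edist (pos d1) (pos d2))%R &
      (edist (pos d) (pos d2) <= edist (pos d1) (pos d2))%R].

(** Take the vertex with the least sum of distances to the others: in the comparison with another
    vertex the side joining the two cancels. *)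
Lemma exists_apex (C : {set V}) : #|C| = 3 -> exists2 d, d \in C & apex C d.
Proof.
move=> C3; have [C0|[c cC]] := set_0Vmem C; first by rewrite C0 cards0 in C3.
pose F d := (\sum_(x in C) edist (pos d) (pos x))%R.
case: (arg_minP F cC) => d dC' dmin'; have dC : d \in C := dC'.
have dmin x : x \in C -> (F d <= F x)%R := dmin' x; exists d => //.
have /eqP/cards2P[d1 [d2 [n12 E]]] : #|C :\ d| = 2 by move: C3; rewrite (cardsD1 d) dC => -[].
have dn : d \notin [set d1; d2] by rewrite -E setD11.
have EC : C = [set d; d1; d2] by rewrite -(setD1K dC) E setUA.
have FE x : F x = (edist (pos x) (pos d) + (edist (pos x) (pos d1) + edist (pos x) (pos d2)))%R.
  by rewrite /F EC -setUA big_setU1 //= big_setU1 ?in_set1 //= big_set1.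
exists d1, d2; split=> //.
  have := dmin d2 ; rewrite !FE !edistxx EC !inE eqxx orbT => /(_ isT).
  by rewrite (edistC (pos d2) (pos d)) (edistC (pos d2) (pos d1)); lra.
have := dmin d1 ; rewrite !FE !edistxx EC !inE eqxx orbT => /(_ isT).
by rewrite (edistC (pos d1) (pos d)); lra.
Qed.

(* A vertex covered three times charges the vertex opposite to a longest side
   of its triangle a little more than the other two. *)
Lemma exists_charge (s : V) : exists w : V -> R,
  [/\ (\sum_(d in cover s) w d = 1)%R,
      forall d, (w d <= 1 / 2)%R,
      2 < #|cover s| -> forall d, (w d <= 38 / 100)%R &
      2 < #|cover s| -> forall d, d \in cover s -> (31 / 100 < w d)%R -> apex (cover s) d].
Proof.
have c2 : 2 <= #|cover s| := lds.1 s.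
have c0 : (#|cover s|%:R != 0 :> R)%R by rewrite pnatr_eq0; lia.
have [c3|n3] := eqVneq #|cover s| 3.
  have [a aC ha] := exists_apex c3.
  (* The total is 0.38 + 2 * 0.31 = 1. *)
  exists (fun d => if d == a then 38 / 100 else 31 / 100)%R; split.
  - rewrite (big_setD1 a) //= eqxx (eq_bigr (fun=> 31 / 100)%R); last first.
      by move=> d /setD1P[/negPf->].
    have -> : (\sum_(i in cover s :\ a) 31 / 100 = (31 / 100) *+ 2 :> R)%R.
      by move: c3; rewrite sumr_const (cardsD1 a) aC add1n => -[->].
    by lra.
  - by move=> d; case: ifP => _; lra.
  - by move=> _ d; case: ifP => _; lra.
  by move=> _ d _; case: eqP => [->//|_]; lra.
exists (fun=> #|cover s|%:R^-1)%R.
(* With two vertices the shares are 1/2 and the last two clauses are vacuous; with four or more they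
   are at most 1/4, below 0.31. *)
have [c4|] := leqP 4 #|cover s|; last first.
  move=> lt4; have c : #|cover s| = 2 by lia.
  by rewrite c; split=> [|d|//|//]; rewrite ?sumr_const ?c; lra.
have le4 : (#|cover s|%:R^-1 <= 4^-1 :> R)%R.
  by rewrite lef_pV2 ?posrE ?ltr0n ?ler_nat //; lia.
split; last 1 first.
- by move=> _ d _; lra.
- by rewrite sumr_const -[LHS]mulr_natr mulVf.
- by move=> _; lra.
by move=> _ _; lra.
Qed.

Variable K : 'I_3 -> {set V}.
Hypothesis indep_K : forall j, independent e (K j).
Hypothesis not_all_K : forall s, exists j, s \notin K j.

(** Pairs rather than vertices, since a vertex in two of the sets [K j] pays a charge for each of
    them. *)
Let heavy d := [set x : 'I_3 * V | (x.2 \in K x.1 :&: cnbr e d) && (2 < #|cover x.2|)].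

Lemma mem_heavy d j s : s \in K j :&: cnbr e d ->
  ((j, s) \in heavy d) = (2 < #|cover s|).
Proof. by move=> sK; rewrite inE sK. Qed.

Lemma cover_pair d m s : d \in Dstar -> m \in Dstar -> d != m ->
  s \in cnbr e d -> s \in cnbr e m -> #|cover s| <= 2 -> cover s = [set d; m].
Proof.
move=> dD mD dm sd sm c2; apply/eqP; rewrite eq_sym eqEcard cards2 dm c2 andbT.
by rewrite subUset !sub1set !in_setI dD mD !(cnbr_sym udg s) sd sm.
Qed.

(** Distinct [s] and [t] would violate the second condition on a liar's dominating set. *)
Lemma cover_pair_inj s t (P : {set V}) : #|P| = 2 -> cover s = P -> cover t = P -> s = t.
Proof.
move=> P2 sP tP; apply/eqP/negPn/negP => /(lds.2 s t).
by rewrite setIUl -/(cover s) -/(cover t) sP tP setUid P2.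
Qed.

(* The D*-neighbours m of a full vertex: each lens with m meets all three K's,
   but contains at most one vertex covered only twice. *)
Lemma full_disk_heavy d : d \in Dstar ->
  (forall j, #|K j :&: cnbr e d| = 5) -> #|heavy d| <= 1 ->
  exists j v, [/\ heavy d = [set (j, v)],
    v \in K j :&: cnbr e d & ~ apex (cover v) d].
Proof.
move=> dD full le1.
have lens m j : m \in cover d -> exists2 s, s \in K j :&: cnbr e d & s \in cnbr e m.
  by case/setIP=> md _; apply: (full_disk_lens udg) (full j) md.
have pair m j s : m \in cover d -> m != d -> s \in K j :&: cnbr e d -> s \in cnbr e m ->
    (j, s) \notin heavy d -> cover s = [set d; m].
  move=> /setIP[_ mD] mnd sK sm; rewrite mem_heavy // -leqNgt => c2.
  by apply: cover_pair => //; [rewrite eq_sym | case/setIP: sK].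
have dd : d \in cover d by rewrite in_setI dD cnbr_refl.
(* If the lens with [m] had no heavy element, all three sets would meet it in vertices covered by
   [d] and [m] only. There is just one such vertex, so it would lie in all three sets. *)
have hv m : m \in cover d -> m != d -> exists j v, (j, v) \in heavy d /\ v \in cnbr e m.
  move=> mc mnd; have [s0 s0K s0m] := lens m ord0 mc.
  case: (boolP [exists j, [exists v, ((j, v) \in heavy d) && (v \in cnbr e m)]]).
    by move=> /existsP[j /existsP[v /andP[? ?]]]; exists j, v.
  rewrite negb_exists => /forallP none.
  have nh j s : s \in cnbr e m -> (j, s) \notin heavy d.
    move=> sm; have := none j; rewrite negb_exists => /forallP/(_ s).
    by rewrite negb_and sm orbF.
  have [j /negP[]] := not_all_K s0.
  have [s sK sm] := lens m j mc.
  have P2 : #|[set d; m]| = 2 by rewrite cards2 eq_sym mnd.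
  rewrite (@cover_pair_inj s0 s [set d; m]) //.
  - by case/setIP: sK.
  - by apply: (pair m ord0) => //; apply: nh.
  by apply: (pair m j) => //; apply: nh.
have [m0 m0c m0d] : exists2 m, m \in cover d & m != d.
  have := lds.1 d; rewrite -/(cover d) (cardsD1 d) dd ltnS card_gt0.
  by case/set0Pn=> m /setD1P[? ?]; exists m.
have [j [v [jv _]]] := hv m0 m0c m0d.
have hE : heavy d = [set (j, v)].
  by apply/esym/eqP; rewrite eqEcard sub1set jv cards1.
have vK : v \in K j :&: cnbr e d by move: jv; rewrite inE => /andP[].
exists j, v; split=> // -[d1 [d2 [cE d12 dn le1' le2']]].
have vm m : m \in cover d -> m != d -> v \in cnbr e m.
  by move=> mc md; have [j' [v' []]] := hv m mc md; rewrite hE in_set1 => /eqP[_ ->].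
have [i ij] : exists i : 'I_3, i != j.
  exists (if j == ord0 then ord_max else ord0); case: ifP => [/eqP->//|h].
  by rewrite eq_sym h.
(* Outside [K j] nothing is heavy, so the two other sets meet the lens with [m] in the same
   vertex. *)
have other m : m \in cover d -> m != d ->
    exists2 u, cover u = [set d; m] & forall i, i != j -> u \in K i.
  move=> mc md; have [u uK um] := lens m i mc.
  have P2 : #|[set d; m]| = 2 by rewrite cards2 eq_sym md.
  have nh k s : k != j -> (k, s) \notin heavy d.
    by rewrite hE in_set1 xpair_eqE => /negPf->.
  have cu : cover u = [set d; m] by apply: (pair m i) => //; apply: nh.
  exists u => // k kj; have [s sK sm] := lens m k mc.
  rewrite (@cover_pair_inj u s [set d; m]) //; first by case/setIP: sK.
  by apply: (pair m k) => //; apply: nh.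
(* Every lens contains the heavy vertex [v], so the neighbours of [d] in [Dstar] belong to the
   triangle of [v]. *)
have subC : cover d :\ d \subset [set d1; d2].
  apply/subsetP => m /setD1P[md mc]; have := vm m mc md.
  case/setIP: mc => _ mD; rewrite (cnbr_sym udg) => mv.
  have : m \in cover v by rewrite in_setI mv.
  by rewrite cE -setUA in_setU1 (negPf md).
(* If [d] had a single neighbour [m] in [Dstar], the vertex given by [other] would have the same
   cover as [d], hence be [d]. Then [d] would be alone in its disk within [K i], not one of five. *)
have Md : cover d :\ d = [set d1; d2].
  apply/eqP; rewrite eqEcard subC cards2 d12 leqNgt; apply/negP => lt.
  have /eqP/cards1P[m Em] : #|cover d :\ d| = 1.
    apply/eqP; rewrite eqn_leq -ltnS lt card_gt0.
    by apply/set0Pn; exists m0; rewrite in_setD1 m0d.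
  have /setD1P[md mc] : m \in cover d :\ d by rewrite Em set11.
  have [u cu uK] := other m mc md.
  have P2 : #|[set d; m]| = 2 by rewrite cards2 eq_sym md.
  have ud : u = d by apply: (cover_pair_inj P2 cu); rewrite -(setD1K dd) Em.
  have := full i; rewrite (_ : _ :&: _ = [set d]) ?cards1 //.
  have dK : d \in K i by rewrite -ud uK.
  apply/setP => x; rewrite in_setI in_set1; apply/andP/eqP => [[xK xd]|->].
    by apply/eqP; rewrite -(independent_cnbr (indep_K i) dK xK).
  by rewrite dK cnbr_refl.
have [d1M d2M] : d1 \in cover d :\ d /\ d2 \in cover d :\ d.
  by rewrite Md !inE !eqxx orbT.
have [/setD1P[n1 c1] /setD1P[n2 c2]] := (d1M, d2M).
(* The 60-degree argument puts a second vertex [x] of [K j] in a lens. It is not heavy, so it is the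
   vertex shared by the two other sets and lies in all three. *)
have /card_gt1P[s [t [sT tT st]]] : 1 < #|K j :&: cnbr e d :&: (cnbr e d1 :|: cnbr e d2)|.
  by apply: (full_disk_two_lenses udg) => //; [case/setIP: c1 | case/setIP: c2].
have [x] : exists2 x, x != v & x \in K j :&: cnbr e d :&: (cnbr e d1 :|: cnbr e d2).
  by case: (eqVneq s v) => [sv|sv]; [exists t; rewrite // -sv eq_sym | exists s].
move=> xv /setIP[xK]; have [xKj _] := setIP xK.
have nx : (j, x) \notin heavy d by rewrite hE in_set1 xpair_eqE (negPf xv) andbF.
have contra m : m \in cover d -> m != d -> x \in cnbr e m -> False.
  move=> mc md xm; have [u cu uK] := other m mc md.
  have P2 : #|[set d; m]| = 2 by rewrite cards2 eq_sym md.
  have xu : x = u by apply: (cover_pair_inj P2 _ cu); apply: (pair m j).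
  have [k /negP[]] := not_all_K x.
  by case: (eqVneq k j) => [->|/uK]; rewrite ?xu -?xu.
by case/setUP; [apply: contra c1 n1 | apply: contra c2 n2].
Qed.

(** Double counting: each element of each [K j] hands out one unit, and regrouping by receiver
    leaves a bound of 7.31 for every [d]. *)
Lemma card_three_independent :
  ((\sum_j #|K j|)%:R <= 731 / 100 * #|Dstar|%:R :> R)%R.
Proof.
have [w hw] := fin_all_exists exists_charge.
pose X d := [set x : 'I_3 * V | x.2 \in K x.1 :&: cnbr e d].
have cardX d : #|X d| = \sum_j #|K j :&: cnbr e d|.
  rewrite -sum1_card (eq_bigl (fun x => predT x.1 && (x.2 \in K x.1 :&: cnbr e d))).
    by rewrite -(pair_big_dep predT (fun j s => s \in K j :&: cnbr e d) (fun _ _ => 1)) /=;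
      apply: eq_bigr => j _; rewrite sum1_card.
  by move=> x; rewrite inE.
have five j d := card_independent_disk udg d (indep_K j).
have -> : ((\sum_j #|K j|)%:R = \sum_(d in Dstar) \sum_(x in X d) w x.2 d :> R)%R.
  transitivity (\sum_j \sum_(s in K j) \sum_(d in cover s) w s d)%R.
    rewrite natr_sum; apply: eq_bigr => j _.
    rewrite (eq_bigr (fun=> 1%R)) ?sumr_const // => s _.
    by case: (hw s).
  rewrite pair_big_dep /= (exchange_big_dep (mem Dstar)) /=; last first.
    by move=> x d _ /setIP[].
  apply: eq_bigr => d dD; apply: eq_bigl => x.
  by rewrite /cover [RHS]inE !in_setI dD andbT (cnbr_sym udg d).
rewrite mulr_natr -sumr_const; apply: ler_sum => d dD.
have bnd (H : {set 'I_3 * V}) (a : R) :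
    {in H, forall x, w x.2 d <= a}%R -> (\sum_(x in H) w x.2 d <= #|H|%:R * a)%R.
  move=> hH; rewrite mulr_natl -sumr_const; exact: ler_sum.
have half (x : 'I_3 * V) : (w x.2 d <= 1 / 2)%R by case: (hw x.2).
have hX : heavy d \subset X d by apply/subsetP => x; rewrite !inE => /andP[].
have splitX : (\sum_(x in X d) w x.2 d =
    \sum_(x in heavy d) w x.2 d + \sum_(x in X d :\: heavy d) w x.2 d)%R.
  by rewrite (big_setID (heavy d)) /= (setIidPr hX).
have cD : #|X d| = #|heavy d| + #|X d :\: heavy d|.
  by rewrite -(cardsID (heavy d)) (setIidPr hX).
have light := bnd (X d :\: heavy d) (1 / 2)%R (fun x _ => half x).
have le15 : #|X d| <= 15.
  rewrite cardX (leq_trans (leq_sum _ (fun j _ => five j d))) //.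
  by rewrite sum_nat_const card_ord.
(* Fourteen charges of at most 1/2 make at most 7. *)
have [le14|gt14] := leqP #|X d| 14.
  apply: le_trans (bnd (X d) (1 / 2)%R (fun x _ => half x)) _.
  have : (#|X d|%:R <= 14 :> R)%R by rewrite ler_nat.
  by lra.
have c15 : #|X d| = 15 by lia.
have full j : #|K j :&: cnbr e d| = 5.
  apply/eqP; rewrite eqn_leq five leqNgt; apply/negP => lt.
  have le10 : \sum_(i < 3 | i != j) #|K i :&: cnbr e d| <= 10.
    apply: leq_trans (leq_sum _ (fun i _ => five i d)) _.
    by rewrite sum_nat_const cardC1 card_ord.
  have := leq_add lt le10; move: c15; rewrite cardX (bigD1 j) //= addSn => ->.
  by [].
have [le1|gt1] := leqP #|heavy d| 1.
  have [j [v [hE vK nap]]] := full_disk_heavy dD full le1.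
  have hv : (j, v) \in heavy d by rewrite hE set11.
  have [_ _ _ w31] := hw v.
  have wv : (w v d <= 31 / 100)%R.
    rewrite leNgt; apply/negP => gt; apply/nap/w31 => //.
      by move: hv; rewrite mem_heavy.
    by case/setIP: vK => _ vd; rewrite in_setI dD (cnbr_sym udg v) vd.
  have c14 : #|X d :\: heavy d| = 14 by move: cD; rewrite c15 hE cards1; lia.
  by rewrite splitX {1}hE big_set1 /=; move: light; rewrite c14; lra.
(* With at least two heavy pairs the total is at most 2 * 0.38 + 13 / 2 = 7.26. *)
have hb : (\sum_(x in heavy d) w x.2 d <= #|heavy d|%:R * (38 / 100))%R.
  by apply: bnd => // x; rewrite inE => /andP[_ c]; case: (hw x.2) => _ _ /(_ c).
have : ((#|heavy d| + #|X d :\: heavy d|)%:R = 15 :> R)%R by rewrite -cD c15.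
have : (2 <= #|heavy d|%:R :> R)%R by rewrite ler_nat.
by rewrite splitX natrD; move: light hb; lra.
Qed.

End Charging.

(** * Runs of the algorithm *)

Section Runs.
Variables (V : finType) (e : rel V).
Hypotheses (e_irr : irreflexive e) (e_sym : symmetric e).

Lemma maximal_independentP (W I : {set V}) :
  reflect [/\ I \subset W, independent e I &
              forall v, v \in W -> v \notin I -> exists2 w, w \in I & e v w]
          (maximal_independent_in e W I).
Proof.
apply: (iffP maxsetP) => [[/andP[IW iI] maxI]|[IW iI dom]].
  split=> // v vW vI; apply/exists_inP; apply: contraT; rewrite negb_exists_in => /forall_inP h.
  case/negP: vI; rewrite -(maxI (v |: I)) ?setU11 ?subsetU1 //.
  rewrite subUset sub1set vW IW; apply/independentP => x y.
  rewrite !in_setU1 => /predU1P[->|xI] /predU1P[->|yI]; rewrite ?e_irr //.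
  - exact: h.
  - by rewrite e_sym; apply: h.
  by move/independentP: iI; apply.
split=> [|J /andP[JW iJ] IJ]; first by rewrite IW.
apply/eqP; rewrite eqEsubset IJ andbT; apply/subsetP => v vJ.
apply/negPn/negP => vI; have [w wI vw] := dom v (subsetP JW v vJ) vI.
by have := independentP _ _ iJ v w vJ (subsetP IJ w wI); rewrite vw.
Qed.

(** The same three conditions also describe the round with empty [W], so later arguments have no
    case distinction. *)
Lemma select_roundP (W I : {set V}) : select_round e W I <->
  [/\ I \subset W, independent e I &
      forall v, v \in W -> v \notin I -> exists2 w, w \in I & e v w].
Proof.
rewrite /select_round; case: eqP => [->|_]; last by split=> /maximal_independentP.
split=> [->|[]]; last by rewrite subset0 => /eqP.
split=> [||v]; rewrite ?subxx ?in_set0 //.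
by apply/independentP => u v; rewrite in_set0.
Qed.

(** * The last loop as a relation between sets *)

Section Augment.
Variables I2 I3 : {set V}.
Implicit Types (u : V) (D : {set V}).

Lemma augment_sub u D D' : augment e I2 I3 u D D' -> D \subset D'.
Proof. by case=> *; rewrite ?subsetU1. Qed.

Lemma augment_all_sub us D D' : augment_all e I2 I3 us D D' -> D \subset D'.
Proof.
elim: us D => [|u us IH] D /= => [->|[D1 /augment_sub s1 /IH]] //.
exact: subset_trans.
Qed.

(** Of the other iterations only monotonicity is kept: what the iteration of [u] adds is still
    present at the end. *)
Lemma augment_all_step us D D' u : augment_all e I2 I3 us D D' -> u \in us ->
  exists D1 D2, [/\ D \subset D1, augment e I2 I3 u D1 D2 & D2 \subset D'].
Proof.
elim: us D => [|x us IH] //= D [D1 a1 a2]; rewrite in_cons => /predU1P[->|us_u].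
  by exists D, D1; rewrite subxx (augment_all_sub a2).
have [E1 [E2 [s1 a s2]]] := IH _ a2 us_u.
by exists E1, E2; rewrite (subset_trans (augment_sub a1)).
Qed.

Definition thin u := #|nbr e u :&: (I2 :|: I3)| <= 1.

Lemma card_augment u D D' : augment e I2 I3 u D D' -> #|D'| <= #|D| + thin u.
Proof.
case=> [v E _|v w E _ _|lt]; rewrite /thin ?E ?cards0 ?cards1 ?cardsU1 ?leq_addr //.
all: by case: (_ \notin _); rewrite addnC //= addn0 addn1.
Qed.

Lemma card_augment_all us D D' :
  augment_all e I2 I3 us D D' -> #|D'| <= #|D| + count thin us.
Proof.
elim: us D => [|u us IH] D /= => [->|[D1 /card_augment c1 /IH c2]]; first by rewrite addn0.
by rewrite addnA (leq_trans c2) // leq_add2r.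
Qed.

Lemma augment_all_rcons us u D D1 D2 : augment_all e I2 I3 us D D1 ->
  augment e I2 I3 u D1 D2 -> augment_all e I2 I3 (rcons us u) D D2.
Proof.
elim: us D => [|x us IH] D /= => [->|[D0 a0 /IH h /h]]; last by exists D0.
by exists D2.
Qed.

End Augment.

Lemma leq2_card (A : {set V}) x y : x != y -> x \in A -> y \in A -> 2 <= #|A|.
Proof. by move=> xy xA yA; apply/card_gt1P; exists x, y. Qed.

Lemma leq3_card (A : {set V}) x y z : x != y -> x != z -> y != z ->
  x \in A -> y \in A -> z \in A -> 3 <= #|A|.
Proof.
by move=> xy xz yz xA yA zA; apply/card_gt2P; exists x, y, z; split; split; rewrite // eq_sym.
Qed.

(** A vertex outside [I1] and [I2] has three vertices of [D] in its closed neighbourhood. A vertex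
    of [I2] has itself and a neighbour in [I1]. For [I1] the last loop supplies the missing
    vertices. *)
Lemma algorithm_run_correct I1 I2 I3 D :
  algorithm_run e I1 I2 I3 D -> liars_dominating e D.
Proof.
case=> /select_roundP[_ i1 m1] /select_roundP[s2 i2 m2] /select_roundP[s3 i3 m3].
case=> us pus aug.
have neq u v : e u v -> u != v by apply: contraTneq => ->; rewrite e_irr.
have neq' u v : e u v -> v != u by rewrite eq_sym; apply: neq.
have sD : I1 :|: I2 :|: I3 \subset D := augment_all_sub aug.
have D1 x : x \in I1 -> x \in D by move=> xI; apply: (subsetP sD); rewrite !in_setU xI.
have D2 x : x \in I2 -> x \in D by move=> xI; apply: (subsetP sD); rewrite !in_setU xI orbT.
have D3 x : x \in I3 -> x \in D by move=> xI; apply: (subsetP sD); rewrite !in_setU xI !orbT.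
have n12 v : v \in I2 -> v \notin I1 by move=> /(subsetP s2); rewrite !inE andbT.
have n13 v : v \in I3 -> v \notin I1 by move=> /(subsetP s3); rewrite !inE andbT => /andP[].
have n23 v : v \in I3 -> v \notin I2 by move=> /(subsetP s3); rewrite !inE andbT => /andP[].
have nb1 v : v \notin I1 -> exists2 w, w \in I1 & e v w by move=> ?; apply: m1.
have nb2 v : v \notin I1 -> v \notin I2 -> exists2 w, w \in I2 & e v w.
  by move=> v1 v2; apply: m2; rewrite // !inE v1.
have nb3 v : v \notin I1 -> v \notin I2 -> v \notin I3 -> exists2 w, w \in I3 & e v w.
  by move=> v1 v2 v3; apply: m3; rewrite // !inE v1 v2.
have inN (v w : V) : e v w -> w \in D -> w \in cnbr e v :&: D.
  by move=> vw wD; rewrite in_setI in_cnbr vw orbT.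
have inN0 (v : V) : v \in D -> v \in cnbr e v :&: D by move=> vD; rewrite in_setI in_cnbr eqxx.
have dif (A B : {set V}) x y : (forall z, z \in B -> z \notin A) -> x \in A -> y \in B -> x != y.
  by move=> h xA; apply: contraTneq => <-; apply/negP => /h; rewrite xA.
have step u : u \in I1 ->
    [\/ 3 <= #|cnbr e u :&: D|,
        (exists x, [/\ e u x, x \in D & nbr e u :&: (I2 :|: I3) = set0]) |
        exists v w, [/\ nbr e u :&: (I2 :|: I3) = [set v], e v w, w != u & w \in D]].
  move=> uI; have : u \in us by rewrite (perm_mem pus) mem_enum.
  case/(augment_all_step aug) => E1 [E2 [_ a sE2]]; case: a sE2.
  - move=> v E vu sE2; constructor 2; exists v; split=> //.
      by move: vu; rewrite inE.
    by apply: (subsetP sE2); rewrite setU11.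
  - move=> v w E vw wu sE2; constructor 3; exists v, w; split=> //.
      by move: vw; rewrite inE.
    by apply: (subsetP sE2); rewrite setU11.
  move=> /card_gt1P[x [y [/setIP[xu x23] /setIP[yu y23] xy]]] _; constructor 1.
  have inD z : z \in I2 :|: I3 -> z \in D by case/setUP; auto.
  move: xu yu; rewrite !inE => xu yu.
  by apply: (@leq3_card _ u x y); eauto using inN0, inN, D1, D2, D3, neq, neq', inD.
have two u : u \in I1 -> 2 <= #|cnbr e u :&: D|.
  move=> uI; case: (step u uI) => [/ltnW //|[x [ux xD _]]|[v [w [E _ _ _]]]].
    by apply: (@leq2_card _ u x); eauto using inN0, inN, D1, D2, D3, neq, neq'.
  have : v \in nbr e u :&: (I2 :|: I3) by rewrite E set11.
  rewrite !inE => /andP[uv v23].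
  have vD : v \in D by case/orP: v23 => [/D2|/D3].
  by apply: (@leq2_card _ u v); eauto using inN0, inN, D1, D2, D3, neq, neq'.
have three v : v \notin I1 -> v \notin I2 -> 3 <= #|cnbr e v :&: D|.
  move=> v1 v2; have [x xI vx] := nb1 v v1; have [y yI vy] := nb2 v v1 v2.
  have xy : x != y by apply: (dif I1 I2).
  case: (boolP (v \in I3)) => [vI|v3].
    by apply: (@leq3_card _ v x y); eauto using inN0, inN, D1, D2, D3, neq, neq'.
  have [z zI vz] := nb3 v v1 v2 v3.
  have xz : x != z by apply: (dif I1 I3).
  have yz : y != z by apply: (dif I2 I3).
  by apply: (@leq3_card _ x y z); eauto using inN0, inN, D1, D2, D3, neq, neq'.
split=> [v|u v uv].
  case: (boolP (v \in I1)) => [/two //|v1]; case: (boolP (v \in I2)) => [vI|v2].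
    have [x xI vx] := nb1 v v1.
    by apply: (@leq2_card _ v x); eauto using inN0, inN, D1, D2, D3, neq, neq'.
  exact/ltnW/three.
have inU x : (x \in cnbr e u :&: D) || (x \in cnbr e v :&: D) ->
    x \in (cnbr e u :|: cnbr e v) :&: D by rewrite setIUl in_setU.
have union3 : 3 <= #|cnbr e u :&: D| \/ 3 <= #|cnbr e v :&: D| ->
    3 <= #|(cnbr e u :|: cnbr e v) :&: D|.
  by case=> h; apply: leq_trans h (subset_leq_card _); apply/subsetP => x xu; apply: inU;
    rewrite xu ?orbT.
(* The vertex [y] has a neighbour in [I1]. If it is not [x], it is the third vertex. If it is [x],
   then [x] has a neighbour in [I2], and unless [x] already has three vertices, the loop chose a
   neighbour of [y] other than [x]. *)
have mixed x y : x != y -> x \in I1 -> y \in I2 ->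
    (forall z, (z \in cnbr e x :&: D) || (z \in cnbr e y :&: D) ->
       z \in (cnbr e u :|: cnbr e v) :&: D) ->
    (3 <= #|cnbr e x :&: D| -> 3 <= #|(cnbr e u :|: cnbr e v) :&: D|) ->
    3 <= #|(cnbr e u :|: cnbr e v) :&: D|.
  move=> xy xI yI inXY h3.
  have [z zI yz] := nb1 y (n12 y yI).
  have inXl z' : z' \in cnbr e x :&: D -> z' \in (cnbr e u :|: cnbr e v) :&: D.
    by move=> zN; apply: inXY; rewrite zN.
  have inXr z' : z' \in cnbr e y :&: D -> z' \in (cnbr e u :|: cnbr e v) :&: D.
    by move=> zN; apply: inXY; rewrite zN orbT.
  have third t : t != x -> t != y -> (t \in cnbr e x :&: D) || (t \in cnbr e y :&: D) ->
      3 <= #|(cnbr e u :|: cnbr e v) :&: D|.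
    move=> tx ty tN; apply: (@leq3_card _ x y t); rewrite // 1?eq_sym //.
    - exact/inXl/inN0/D1.
    - exact/inXr/inN0/D2.
    by case/orP: tN; auto.
  have [Ez|zx] := eqVneq z x; last first.
    by apply: (third z); rewrite ?(inN y z) ?orbT; auto.
  case: (step x xI) => [/h3 //|[t [xt tD E0]]|[v' [w [Ev v'w wx wD]]]].
    have : y \in nbr e x :&: (I2 :|: I3) by rewrite !inE e_sym -Ez yz yI.
    by rewrite E0 inE.
  have : y \in nbr e x :&: (I2 :|: I3) by rewrite !inE e_sym -Ez yz yI.
  rewrite Ev in_set1 => /eqP yv; rewrite -yv in v'w.
  by apply: (third w); rewrite ?(inN y w) ?orbT; auto.
case: (boolP (u \in I1)) => [uI|u1].
  case: (boolP (v \in I1)) => [vI|v1].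
    (* The second vertex of [D] near [u] differs from [v], since [u] and [v] are not adjacent. *)
    have /card_gt1P[x [y [xN yN xy]]] := two u uI.
    have [t tu tN] : exists2 t, t != u & t \in cnbr e u :&: D.
      by have [xu|xu] := eqVneq x u; [exists y; rewrite // -xu eq_sym | exists x].
    have tv : t != v.
      apply: contraTneq tN => ->; rewrite in_setI in_cnbr eq_sym (negPf uv) /=.
      by rewrite (negPf (independentP _ _ i1 u v uI vI)).
    by apply: (@leq3_card _ u v t); rewrite // 1?eq_sym //; apply: inU;
      rewrite ?tN ?(inN0 u) ?(inN0 v) ?orbT; auto.
  case: (boolP (v \in I2)) => [vI|v2]; last by apply: union3; right; apply: three.
  by apply: (mixed u v) => // h; apply: union3; left.
case: (boolP (u \in I2)) => [uI|u2]; last by apply: union3; left; apply: three.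
case: (boolP (v \in I1)) => [vI|v1].
  apply: (mixed v u) => //; first by rewrite eq_sym.
    by move=> z; rewrite orbC; apply: inU.
  by move=> h; apply: union3; right.
case: (boolP (v \in I2)) => [vI|v2]; last by apply: union3; right; apply: three.
have [x xI ux] := nb1 u u1.
have xv : x != v by apply: (dif I1 I2).
apply: (@leq3_card _ u v x); rewrite // 1?eq_sym; auto.
all: by apply: inU; rewrite ?(inN0 u) ?(inN0 v) ?(inN u x) ?orbT; auto.
Qed.

End Runs.

Lemma algorithm_run_ratio (R : realType) (V : finType) (e : rel V) I1 I2 I3 D Dstar :
  unit_disk_graph R e -> algorithm_run e I1 I2 I3 D -> liars_dominating e Dstar ->
  (#|D|%:R <= 731%:R / 100%:R * #|Dstar|%:R :> R)%R.
Proof.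
case=> pos udg [r1 r2 r3 [us pus aug]] lds.
have irr := udg_irr udg; have sym := udg_sym udg.
have [_ i1 _] := (select_roundP irr sym _ _).1 r1.
have [s2 i2 _] := (select_roundP irr sym _ _).1 r2.
have [s3 i3 _] := (select_roundP irr sym _ _).1 r3.
have n12 v : v \in I2 -> v \notin I1 by move=> /(subsetP s2); rewrite !inE andbT.
have n13 v : v \in I3 -> v \notin I1 by move=> /(subsetP s3); rewrite !inE andbT => /andP[].
have n23 v : v \in I3 -> v \notin I2 by move=> /(subsetP s3); rewrite !inE andbT => /andP[].
pose P := [set u in I1 | thin e I2 I3 u].
pose P2 := [set u in P | [disjoint nbr e u & I2]].
pose P3 := P :\: P2.
(* Such a [u] has a neighbour in [I2]; one in [I3] would be a second element, as [I2] and [I3] are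
   disjoint. *)
have P3I3 u : u \in P3 -> [disjoint nbr e u & I3].
  rewrite !inE => /andP[+ /andP[uI th]]; rewrite uI th /= => /pred0Pn[x /andP[/= xu x2]].
  apply/pred0P => y /=; apply/negP => /andP[yu y3].
  move: th; rewrite /thin leqNgt => /card_gt1P[]; exists x, y; split.
  - by rewrite in_setI xu in_setU x2.
  - by rewrite in_setI yu in_setU y3 orbT.
  by apply: contraTneq x2 => ->; apply: n23.
have indU (I J : {set V}) : independent e I -> J \subset P ->
  {in J, forall u, [disjoint nbr e u & I]} ->
    independent e (I :|: J).
  move=> iI /subsetP JP dJ.
  have cross u v : u \in I -> v \in J -> ~~ e v u.
    move=> uI /dJ /pred0P/(_ u); rewrite /= uI andbT inE.
    by move=> ->.
  have PI1 u : u \in J -> u \in I1 by move=> /JP; rewrite inE => /andP[].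
  apply/independentP => u v /setUP[uI|uJ] /setUP[vI|vJ].
  - by move/independentP: iI; apply.
  - by rewrite sym cross.
  - exact: cross.
  by move/independentP: i1; apply; apply: PI1.
pose K (j : 'I_3) := if j == 0 :> nat then I1 else if j == 1 :> nat then I2 :|: P2 else I3 :|: P3.
have iK j : independent e (K j).
  rewrite /K; case: ifP => // _; case: ifP => _; apply: indU => //.
  - by apply/subsetP => u; rewrite inE => /andP[].
  - by move=> u; rewrite inE => /andP[].
  by apply: subsetDl.
(* A vertex of [I1] is in neither [I2] nor [I3], and in at most one of [P2] and [P3]. *)
have nK s : exists j, s \notin K j.
  case: (boolP (s \in K 0%R)) => [s1|]; last by exists 0%R.
  rewrite /K /= in s1.
  case: (boolP (s \in P2)) => sP; [exists (inord 2) | exists (inord 1)];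
    rewrite /K inordK //= in_setU negb_or.
    by rewrite !in_setD sP /= andbT; apply: contraL s1; apply: n13.
  by rewrite sP andbT; apply: contraL s1; apply: n12.
apply: le_trans (card_three_independent udg lds iK nK).
rewrite ler_nat; apply: leq_trans (card_augment_all aug) _.
rewrite !big_ord_recr big_ord0 /= add0n /K /=.
have -> : count (thin e I2 I3) us = #|P|.
  rewrite (permP pus) -size_filter cardE; congr size; rewrite /enum_mem -!filter_predI.
  by apply: eq_filter => x; rewrite /= !inE andbC.
have P1 u : u \in P -> u \in I1 by rewrite inE => /andP[].
have cU (I J : {set V}) : J \subset P -> (forall v, v \in I -> v \notin I1) ->
  #|I :|: J| = #|I| + #|J|.
  move=> /subsetP JP nI; rewrite cardsU (_ : I :&: J = set0) ?cards0 ?subn0 //.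
  apply/setP => x; rewrite !inE; apply/negP => /andP[/nI xI /JP/P1].
  by rewrite (negPf xI).
have sP2 : P2 \subset P by apply/subsetP => u; rewrite inE => /andP[].
rewrite (cU I2 P2) // (cU I3 P3) ?subsetDl // -(cardsID P2 P) (setIidPr sP2) -/P3.
have := (leq_card_setU (I1 :|: I2) I3).1; have := (leq_card_setU I1 I2).1.
by lia.
Qed.

(** * Implementation *)

(** A total-correctness triple with an upper bound on the time, so that constants may be rounded
    up. *)
Definition runs c s T (Q : state -> Prop) := exists t s', [/\ exec c s t s', t <= T & Q s'].

Lemma runs_le c s T T' (Q Q' : state -> Prop) : T <= T' -> (forall s', Q s' -> Q' s') ->
  runs c s T Q -> runs c s T' Q'.
Proof.
move=> TT QQ [t [s' [ex tT Qs]]]; exists t, s'; split=> //; last exact: QQ.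
exact: leq_trans TT.
Qed.

Lemma runs_assign r x s (Q : state -> Prop) :
  Q (set_reg s r (eval s x)) -> runs (Assign r x) s (ecost x).+1 Q.
Proof. by move=> h; exists (ecost x).+1, (set_reg s r (eval s x)); split=> //; constructor. Qed.

Lemma runs_store a x y s (Q : state -> Prop) :
  Q (set_arr s a (eval s x) (eval s y)) -> runs (Store a x y) s (ecost x + ecost y).+1 Q.
Proof. by move=> h; eexists _, _; split; [constructor | exact: leqnn | exact: h]. Qed.

Lemma runs_seq c1 c2 s T1 T2 (P Q : state -> Prop) : runs c1 s T1 P ->
  (forall s', P s' -> runs c2 s' T2 Q) -> runs (Seq c1 c2) s (T1 + T2) Q.
Proof.
move=> [t1 [s1 [e1 l1 /[swap] h /h[t2 [s2 [e2 l2 q]]]]]].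
by exists (t1 + t2), s2; split; [apply: Exec_seq e1 e2 | apply: leq_add | ].
Qed.

Lemma runs_assign_seq r x c s T (Q : state -> Prop) :
  runs c (set_reg s r (eval s x)) T Q -> runs (Seq (Assign r x) c) s ((ecost x).+1 + T) Q.
Proof. by move=> h; apply: runs_seq (runs_assign (erefl _)) _ => s' <-. Qed.

Lemma runs_if x c1 c2 s T1 T2 (Q : state -> Prop) :
  (eval s x != 0 -> runs c1 s T1 Q) -> (eval s x = 0 -> runs c2 s T2 Q) ->
  runs (If x c1 c2) s (ecost x + (T1 + T2)).+1 Q.
Proof.
move=> h1 h2; case: (eqVneq (eval s x) 0) => [e0|n0].
  have [t [s' [ex le q]]] := h2 e0; exists (ecost x + t).+1, s'.
  by split; [apply: Exec_if_false | rewrite ltnS leq_add2l (leq_trans le) ?leq_addl | ].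
have [t [s' [ex le q]]] := h1 n0; exists (ecost x + t).+1, s'.
by split; [apply: Exec_if_true | rewrite ltnS leq_add2l (leq_trans le) ?leq_addr | ].
Qed.

(** The cost is a sum over iterations, not a number of iterations times a worst case; this lets
    short and long adjacency lists add up to the sum of the degrees. The last summand pays for the
    failing test. *)
Lemma runs_while (Inv : nat -> state -> Prop) g c (f : nat -> nat) n k s :
  (forall i s', i < n -> Inv i s' -> eval s' g != 0 /\ runs c s' (f i) (Inv i.+1)) ->
  (forall s', Inv n s' -> eval s' g = 0) -> k <= n -> Inv k s ->
  runs (While g c) s (\sum_(k <= i < n) (f i + ecost g).+1 + (ecost g).+1) (Inv n).
Proof.
move=> step stop kn; have [m ->] : exists m, k = n - m by exists (n - k); rewrite subKn.
elim: m s {k kn} => [|m IH] s.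
  rewrite subn0 big_geq // => h; exists (ecost g).+1, s; split=> //.
  exact/Exec_while_false/stop.
(* For [n <= m] both truncated differences are 0. *)
case: (leqP n m) => [nm|mn h].
  by have := IH s; rewrite (eqP nm) (eqP (leqW nm)).
rewrite big_ltn; last by lia.
have Sm : (n - m.+1).+1 = n - m by lia.
have lt : n - m.+1 < n by lia.
have [gt [t1 [s1 [e1 l1 q1]]]] := step _ s lt h.
rewrite Sm in q1 *; have [t2 [s2 [e2 l2 q2]]] := IH s1 q1.
exists (ecost g + t1 + t2).+1, s2; split=> //; first exact: Exec_while_true e2.
by move: l1 l2; lia.
Qed.

(** * The program text *)

Definition skip := Assign 6 (Cst 0).

(* Register 2 runs over the cells of array 1 that list the neighbours of the
   vertex in register 1. *)
Definition for_neighbours c :=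
  Seq (Assign 2 (Get 0 (Reg 1)))
 (Seq (Assign 3 (Get 0 (Suc (Reg 1))))
      (While (Ltb (Reg 2) (Reg 3)) (Seq c (Assign 2 (Suc (Reg 2)))))).

Definition for_vertices c :=
  Seq (Assign 1 (Cst 0))
      (While (Ltb (Reg 1) (Reg 0)) (Seq c (Assign 1 (Suc (Reg 1))))).

(** Array [o] receives the set of this round, array 5 the union of all rounds. Register 4 tells
    whether a neighbour is already in [o]. *)
Definition greedy o cond :=
  for_vertices
    (If cond
      (Seq (Assign 4 (Cst 0))
      (Seq (for_neighbours (If (Get o (Get 1 (Reg 2))) (Assign 4 (Cst 1)) skip))
           (If (Reg 4) skip
              (Seq (Store o (Reg 1) (Cst 1)) (Store 5 (Reg 1) (Cst 1))))))
      skip).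

(** Degree 1, read off from consecutive offsets because the machine cannot subtract. *)
Definition pendant_cond := Eqb (Get 0 (Suc (Reg 1))) (Suc (Get 0 (Reg 1))).
Definition unselected_cond := Eqb (Get 5 (Reg 1)) (Cst 0).

(* Register 4 counts, up to 2, the neighbours in I2 and I3; register 5 keeps
   the first of them. *)
Definition count_hit :=
  If (Eqb (Reg 4) (Cst 0)) (Seq (Assign 4 (Cst 1)) (Assign 5 (Get 1 (Reg 2))))
     (Assign 4 (Cst 2)).

(** Register 6 takes the first neighbour of the vertex in register 5, or the second if the first is
    the current vertex. The empty branch there writes to register 7, since [skip] would overwrite
    register 6. *)
Definition augment_loop :=
  for_vertices
    (If (Get 2 (Reg 1))
      (Seq (Assign 4 (Cst 0))
      (Seq (for_neighbours
             (If (Get 3 (Get 1 (Reg 2))) count_hit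
             (If (Get 4 (Get 1 (Reg 2))) count_hit skip)))
           (If (Eqb (Reg 4) (Cst 0))
              (Store 5 (Get 1 (Get 0 (Reg 1))) (Cst 1))
           (If (Eqb (Reg 4) (Cst 1))
              (Seq (Assign 6 (Get 1 (Get 0 (Reg 5))))
              (Seq (If (Eqb (Reg 6) (Reg 1))
                      (Assign 6 (Get 1 (Suc (Get 0 (Reg 5))))) (Assign 7 (Cst 0)))
                   (Store 5 (Reg 6) (Cst 1))))
              skip))))
      skip).

(* The pendant vertices go first: with all of them in I1, every vertex of I2
   and I3 has two neighbours, so the choice of w in the last loop cannot fail. *)
Definition program :=
  Seq (greedy 2 pendant_cond)
 (Seq (greedy 2 unselected_cond)
 (Seq (greedy 3 unselected_cond)
 (Seq (greedy 4 unselected_cond) augment_loop))).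

(** * Correctness and running time on a graph given by adjacency lists *)

Section Program.
Variables (V : finType) (e : rel V) (vs : seq V) (adj : V -> seq V).
Hypotheses (e_irr : irreflexive e) (e_sym : symmetric e).
Hypothesis adj_lists : adjacency_lists e vs adj.

Lemma mem_vs v : v \in vs.
Proof. by rewrite (perm_mem adj_lists.1) mem_enum. Qed.

Lemma uniq_vs : uniq vs.
Proof. by rewrite (perm_uniq adj_lists.1) enum_uniq. Qed.

Lemma mem_adj v w : (w \in adj v) = e v w.
Proof. by rewrite (perm_mem (adj_lists.2 v)) mem_enum inE. Qed.

Lemma uniq_adj v : uniq (adj v).
Proof. by rewrite (perm_uniq (adj_lists.2 v)) enum_uniq. Qed.

Lemma size_adj v : size (adj v) = #|nbr e v|.
Proof. by rewrite (perm_size (adj_lists.2 v)) -cardE. Qed.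

Lemma index_inj v w : index v vs = index w vs -> v = w.
Proof. by move=> E; rewrite -(nth_index v (mem_vs v)) E nth_index ?mem_vs. Qed.

Lemma split_vs v : vs = take (index v vs) vs ++ v :: drop (index v vs).+1 vs.
Proof.
rewrite -{1}(cat_take_drop (index v vs) vs) (drop_nth v) ?index_mem ?mem_vs //.
by rewrite nth_index ?mem_vs.
Qed.

Lemma take_rcons v : take (index v vs).+1 vs = rcons (take (index v vs) vs) v.
Proof. by rewrite (take_nth v) ?index_mem ?mem_vs // nth_index ?mem_vs. Qed.

Definition off v := sumn [seq size (adj u) | u <- take (index v vs) vs].

(** The part of the input that the loops read, stated vertex by vertex; it survives writes to
    registers other than 0 and to arrays from 2 on. *)
Definition holds_input s :=
  [/\ reg s 0 = size vs, forall v, arr s 0 (index v vs) = off v,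
      forall v, arr s 0 (index v vs).+1 = off v + size (adj v) &
      forall v k, k < size (adj v) -> arr s 1 (off v + k) = index (nth v (adj v) k) vs].

Lemma holds_input_state : holds_input (input_state vs adj).
Proof.
split=> //= [v|v k kv].
  by rewrite take_rcons map_rcons -cats1 sumn_cat /= addn0.
set F := fun u => [seq index w vs | w <- adj u].
have -> : [seq F u | u <- vs] = [seq F u | u <- take (index v vs) vs] ++
    F v :: [seq F u | u <- drop (index v vs).+1 vs].
  by rewrite {1}(split_vs v) map_cat.
rewrite flatten_cat nth_cat size_flatten /shape -map_comp.
have -> : sumn (map (size \o F) (take (index v vs) vs)) = off v.
  by congr sumn; apply: eq_map => u /=; rewrite size_map.
rewrite ltnNge leq_addr /= addKn nth_cat size_map kv (nth_map v) //.
Qed.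

Lemma holds_input_reg s r k : r != 0 -> holds_input s -> holds_input (set_reg s r k).
Proof. by move=> r0 [h1 h2 h3 h4]; split=> //=; rewrite /upd eq_sym (negPf r0). Qed.

Lemma holds_input_arr s a i k : 1 < a -> holds_input s -> holds_input (set_arr s a i k).
Proof. by case: a => [|[|a]] // _ [h1 h2 h3 h4]; split. Qed.

Lemma holds_input_ext s s' : reg s' 0 = reg s 0 -> arr s' = arr s -> holds_input s ->
  holds_input s'.
Proof. by move=> r a [h1 h2 h3 h4]; split; rewrite ?r ?a. Qed.

Lemma marked_set_arr s a v b : marked vs (set_arr s a (index v vs) 1) b =
  if b == a then v |: marked vs s a else marked vs s b.
Proof.
apply/setP => w; rewrite /marked inE /= /upd; case: (eqVneq b a) => [_|_]; last by rewrite inE.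
rewrite in_setU1 [in RHS]inE; case: (eqVneq w v) => [->|wv]; first by rewrite eqxx.
case: (eqVneq (index w vs) (index v vs)) => [/index_inj E|//].
by rewrite E eqxx in wv.
Qed.

Lemma marked_set_reg s r k : marked vs (set_reg s r k) = marked vs s.
Proof. by []. Qed.

Lemma mem_marked s a v : (v \in marked vs s a) = (arr s a (index v vs) != 0).
Proof. by rewrite inE. Qed.

(** The invariant [P] speaks of the neighbours visited so far. Each of them costs [b], 3 for the
    increment and 4 for the test; 11 pays for the two initial assignments and the failing test. *)
Lemma runs_for_neighbours c b s v (P : seq V -> nat -> nat -> Prop) :
  holds_input s -> reg s 1 = index v vs ->
  (forall s' l x, arr s' = arr s -> reg s' 1 = index v vs -> x \in adj v ->
     arr s' 1 (reg s' 2) = index x vs -> P l (reg s' 4) (reg s' 5) ->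
     runs c s' b (fun s'' => [/\ arr s'' = arr s', forall r, r < 4 -> reg s'' r = reg s' r &
        P (rcons l x) (reg s'' 4) (reg s'' 5)])) ->
  P [::] (reg s 4) (reg s 5) ->
  runs (for_neighbours c) s (size (adj v) * (b + 7) + 11)
    (fun s' => [/\ arr s' = arr s, reg s' 0 = reg s 0, reg s' 1 = reg s 1 &
       P (adj v) (reg s' 4) (reg s' 5)]).
Proof.
move=> [h0 h1 h2 h3] r1 body init.
pose Inv k s' := [/\ arr s' = arr s, reg s' 0 = reg s 0 & reg s' 1 = reg s 1] /\
  [/\ reg s' 2 = off v + k, reg s' 3 = off v + size (adj v) &
      P (take k (adj v)) (reg s' 4) (reg s' 5)].
apply: (@runs_le _ _ _ _ (Inv (size (adj v)))); first last.
- apply/runs_assign_seq/runs_assign_seq.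
  apply: (@runs_while Inv _ _ (fun=> b + 3) (size (adj v)) 0) => //.
  + move=> k s' kv [[ea e0 e1] [e2 e3 p]].
    have xv : nth v (adj v) k \in adj v by rewrite mem_nth.
    have get : arr s' 1 (reg s' 2) = index (nth v (adj v) k) vs by rewrite ea e2 h3.
    split; first by rewrite /= e2 e3 ltn_add2l kv.
    apply: runs_seq (body s' _ _ ea _ xv get p) _; first by rewrite e1.
    move=> s'' [ea' er p']; apply: runs_assign; split; split=> //=; rewrite /upd /=.
    * by rewrite ea'.
    * by rewrite er.
    * by rewrite er.
    * by rewrite er // e2 addnS.
    * by rewrite er.
    by rewrite (take_nth v).
  + by move=> s' [_ [e2 e3 _]]; rewrite /= e2 e3 ltnn.
  split; split=> //=; rewrite /upd /=; rewrite ?r1 ?h1 ?h2 ?addn0 ?take0 //.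
- by move=> s' [[ea e0 e1] [_ _ p]]; split=> //; rewrite take_size in p.
rewrite sum_nat_const_nat subn0 /=; move: (size _) => k; nia.
Qed.

(** A body whose time is affine in the degree gives a loop that is linear in the number of vertices
    and the sum of the degrees. *)
Lemma runs_for_vertices c C D s (Inv : seq V -> (nat -> {set V}) -> Prop) :
  holds_input s ->
  (forall s' l v, holds_input s' -> reg s' 1 = index v vs -> v \notin l ->
     Inv l (marked vs s') ->
     runs c s' (C + D * size (adj v))
       (fun s'' => [/\ holds_input s'', reg s'' 1 = reg s' 1 &
          Inv (rcons l v) (marked vs s'')])) ->
  Inv [::] (marked vs s) ->
  runs (for_vertices c) s (size vs * (C + 7) + D * sumn [seq size (adj v) | v <- vs] + 6)
    (fun s' => holds_input s' /\ Inv vs (marked vs s')).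
Proof.
move=> hin body init.
pose f k := C + D * nth 0 [seq size (adj v) | v <- vs] k + 3.
pose I k s' := [/\ holds_input s', reg s' 1 = k & Inv (take k vs) (marked vs s')].
apply: (@runs_le _ _ _ _ (I (size vs))); first last.
- apply: runs_assign_seq; apply: (@runs_while I _ _ f (size vs) 0) => //.
  + move=> k s' kv [hin' e1 i].
    have [v ev] : exists v, index v vs = k.
      case: vs kv uniq_vs => // v l kv u; exists (nth v (v :: l) k).
      exact: index_uniq.
    have [e0 _ _ _] := hin'; split; first by rewrite /= e0 e1 kv.
    rewrite -ev in e1 i *.
    have vl : v \notin take (index v vs) vs.
      by have := uniq_vs; rewrite {1}(split_vs v) cat_uniq /= => /and3P[_ /norP[]].
    have := body s' _ v hin' e1 vl i => h; rewrite /f (nth_map v) ?index_mem ?mem_vs //.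
    rewrite nth_index ?mem_vs //; apply: runs_seq h _ => s'' [hin'' e1' i'].
    apply: runs_assign; split; first exact: holds_input_reg.
    * by rewrite /= /upd /= e1' e1.
    by rewrite take_rcons.
  + by move=> s' [[e0 _ _ _] e1 _]; rewrite /= e0 e1 ltnn.
  split; rewrite ?take0 //; exact: holds_input_reg.
- by move=> s' [h _]; rewrite take_size.
have -> : sumn [seq size (adj v) | v <- vs] =
  \sum_(0 <= k < size vs) nth 0 [seq size (adj v) | v <- vs] k.
  by rewrite sumnE (big_nth 0) size_map.
have -> : \sum_(0 <= i < size vs) (f i + ecost (Ltb (Reg 1) (Reg 0))).+1 =
    \sum_(0 <= i < size vs) ((C + 7) + D * nth 0 [seq size (adj v) | v <- vs] i).
  by apply: eq_bigr => i _; rewrite /f /=; lia.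
by rewrite big_split sum_nat_const_nat subn0 -big_distrr /=; lia.
Qed.

(** Once all vertices are visited, [M o] is a maximal independent subset of the union of [M0 o] and
    [X]. *)
Definition greedy_inv o (M0 : nat -> {set V}) (X : {set V}) (l : seq V) (M : nat -> {set V}) :=
  [/\ M 5 = M0 5 :|: M o, forall a, a != o -> a != 5 -> M a = M0 a & independent e (M o)] /\
  [/\ M0 o \subset M o, forall v, v \in M o -> v \in M0 o \/ v \in X /\ v \in l &
      forall v, v \in l -> v \in X -> v \notin M o -> exists2 w, w \in M o & e v w].

Lemma runs_greedy o cond (X : {set V}) s : 1 < o -> o != 5 -> ecost cond <= 10 -> holds_input s ->
  marked vs s o \subset marked vs s 5 -> independent e (marked vs s o) ->
  (forall s' v, holds_input s' -> reg s' 1 = index v vs ->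
     (v \in marked vs s' 5) = (v \in marked vs s 5) -> (eval s' cond != 0) = (v \in X)) ->
  runs (greedy o cond) s (size vs * 50 + 20 * sumn [seq size (adj v) | v <- vs] + 6)
    (fun s' => holds_input s' /\ greedy_inv o (marked vs s) X vs (marked vs s')).
Proof.
move=> o1 o5 cost hin sub ind condP.
apply: (@runs_le _ _ (size vs * (43 + 7) + 20 * sumn [seq size (adj v) | v <- vs] + 6)) => //.
  exact: (fun s' h => h).
apply: runs_for_vertices => //; last first.
  split; split=> //; first by apply/esym/setUidPl.
  by move=> v; left.
move=> s' l v hin' r1 vl inv; have [[M5 Ma iM] [M0M Mc dom]] := inv.
(* As [v] is not yet visited, its mark in array 5 is the initial one, so [cond] decides membership
   in [X]. *)
have v5 : (v \in marked vs s' 5) = (v \in marked vs s 5).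
  rewrite M5 in_setU; case: (boolP (v \in marked vs s 5)) => //= /negPf nv.
  apply/negP => /Mc[/(subsetP sub)|[_]]; rewrite ?nv // (negPf vl) //.
have eX := condP s' v hin' r1 v5.
apply: (@runs_le _ _ (ecost cond + ((2 + (size (adj v) * (8 + 7) + 11 + 10)) + 2)).+1).
- by move: cost; lia.
- exact: (fun s' h => h).
apply: runs_if => [nz|z]; last first.
  apply: runs_assign; split; [exact: holds_input_reg | by [] | rewrite marked_set_reg].
  split; split=> // w; first by move/Mc=> [|[? ?]]; [left | right;
    rewrite mem_rcons in_cons orbC; split=> //; apply/orP; left].
  rewrite mem_rcons in_cons => /predU1P[->|/dom //].
  by rewrite -eX z.
have vX : v \in X by rewrite -eX.
apply: runs_assign_seq; set s1 := set_reg _ _ _.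
have hin1 : holds_input s1 by apply: holds_input_reg.
pose P (l : seq V) (c _ : nat) := (c != 0) = has (mem (marked vs s1 o)) l.
apply: runs_seq.
  apply: (@runs_for_neighbours _ 8 s1 v P) => //.
  move=> s2 k x ea _ xv get p.
  apply: (@runs_le _ _ (3 + (2 + 2)).+1) => //; first exact: (fun s' h => h).
  apply: runs_if => /= h; apply: runs_assign; split=> //=; try by case=> [|[|[|[|]]]].
    by rewrite /P /upd /= has_rcons /= mem_marked -ea -get h.
  rewrite /upd /P /= has_rcons /= mem_marked -ea -get h eqxx /=; exact: p.
move=> s2 [ea e0 e1 p].
have hin2 : holds_input s2 by apply: holds_input_ext hin1.
have Ms2 : marked vs s2 = marked vs s' by rewrite /marked ea.
apply: (@runs_le _ _ (1 + (2 + (3 + 3))).+1) => //; first exact: (fun s' h => h).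
apply: runs_if => /= h.
  apply: runs_assign; split; [exact: holds_input_reg | exact: e1 | rewrite marked_set_reg Ms2].
  split; split=> // w.
    by move/Mc=> [|[? ?]]; [left | right; rewrite mem_rcons in_cons orbC; split=> //; apply/orP;
      left].
  rewrite mem_rcons in_cons => /predU1P[->|/dom //] _ _.
  by move: p; rewrite /P h => /esym/hasP[x]; rewrite mem_adj => vx xM; exists x.
apply: runs_seq (runs_store (erefl _)) _ => s3 <-.
apply: runs_store; split;
  [by apply/holds_input_arr/holds_input_arr | exact: e1 | rewrite /= e1 /= /upd /= r1].
have no w : w \in marked vs s' o -> ~~ e v w.
  move=> wM; apply/negP => vw; move: p; rewrite /P h eqxx => /esym/hasP[].
  by exists w; rewrite ?mem_adj.
have E a : marked vs (set_arr (set_arr s2 o (index v vs) 1) 5 (index v vs) 1) a =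
    if (a == 5) || (a == o) then v |: marked vs s' a else marked vs s' a.
  rewrite !marked_set_arr Ms2; case: eqP => [->|_] /=; rewrite ?(eq_sym 5) ?(negPf o5) //.
  by case: eqP => [->|].
rewrite /greedy_inv !E !eqxx orbT /=; split; split.
- by rewrite M5 setUCA.
- by move=> a ao a5; rewrite E (negPf ao) (negPf a5) Ma.
- apply/independentP => x y; rewrite !in_setU1.
  move=> /predU1P[->|xM] /predU1P[->|yM]; rewrite ?e_irr ?no //; first by rewrite e_sym no.
  by move/independentP: iM; apply.
- by rewrite (subset_trans M0M) ?subsetU1.
- move=> w; rewrite in_setU1 mem_rcons in_cons => /predU1P[->|/Mc[]]; rewrite ?eqxx; auto.
  by case=> -> ->; rewrite orbT; auto.
move=> w; rewrite mem_rcons in_cons in_setU1 => /predU1P[->|/dom h']; rewrite ?eqxx // => wX.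
by rewrite negb_or => /andP[_ /(h' wX)[y yM wy]]; exists y; rewrite // in_setU1 yM orbT.
Qed.

(** * The last loop of the program *)

Section AugmentLoop.
Variables (I1 I2 I3 S : {set V}).
Hypothesis deg_gt0 : forall v, 0 < size (adj v).
Hypothesis deg_gt1 : forall v, v \in I2 :|: I3 -> 1 < size (adj v).

Definition count_inv (l : seq V) (c r : nat) :=
  match [seq x <- l | x \in I2 :|: I3] with
  | [::] => c = 0
  | [:: x] => c = 1 /\ r = index x vs
  | _ => c = 2
  end.

Lemma runs_count_hit s l x : arr s 1 (reg s 2) = index x vs -> x \in I2 :|: I3 ->
  count_inv l (reg s 4) (reg s 5) ->
  runs count_hit s 11 (fun s' => [/\ arr s' = arr s, forall r, r < 4 -> reg s' r = reg s r &
    count_inv (rcons l x) (reg s' 4) (reg s' 5)]).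
Proof.
move=> get xJ p; apply: (@runs_le _ _ (3 + (2 + 3 + 2)).+1) => //; first exact: (fun s' h => h).
rewrite /count_inv filter_rcons xJ; move: p; rewrite /count_inv.
case: [seq _ <- _ | _] => [c0|y [|z h] p]; apply: runs_if => /= c.
- apply/runs_assign_seq/runs_assign; split=> //.
  by case=> [|[|[|[|]]]].
- by rewrite c0 in c.
- by rewrite p.1 in c.
- by apply: runs_assign; split=> //; case=> [|[|[|[|]]]].
- by rewrite p in c.
by apply: runs_assign; split=> //; case=> [|[|[|[|]]]].
Qed.

Definition augment_inv (l : seq V) (M : nat -> {set V}) :=
  [/\ M 2 = I1, M 3 = I2, M 4 = I3 &
      augment_all e I2 I3 [seq v <- l | v \in I1] S (M 5)].

Lemma runs_augment_loop s : holds_input s -> augment_inv [::] (marked vs s) ->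
  runs augment_loop s (size vs * 58 + 39 * sumn [seq size (adj v) | v <- vs] + 6)
    (fun s' => holds_input s' /\ augment_inv vs (marked vs s')).
Proof.
move=> hin inv0.
apply: (@runs_le _ _ (size vs * (51 + 7) + 39 * sumn [seq size (adj v) | v <- vs] + 6)) => //.
  exact: (fun s' h => h).
apply: runs_for_vertices => // s' l u hin' r1 _ [M2 M3 M4 aug].
apply: (@runs_le _ _ (2 + ((2 + (size (adj u) * (32 + 7) + 11 + 33)) + 2)).+1).
- by lia.
- exact: (fun s' h => h).
apply: runs_if => [nz|z]; last first.
  apply: runs_assign; split; [exact: holds_input_reg | by [] | rewrite marked_set_reg].
  have uI : u \in I1 = false by rewrite -M2 mem_marked -r1; move: z => /= ->.
  by split; rewrite // filter_rcons uI.
have uI : u \in I1 by rewrite -M2 mem_marked -r1.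
apply: runs_assign_seq; set s1 := set_reg _ _ _.
have hin1 : holds_input s1 by apply: holds_input_reg.
apply: runs_seq.
  apply: (@runs_for_neighbours _ 32 s1 u count_inv) => // s2 k x ea _ xu get p.
  apply: (@runs_le _ _ (3 + (11 + (3 + (11 + 2)).+1)).+1) => //; first exact: (fun s' h => h).
  have in3 : (x \in I2) = (arr s2 3 (arr s2 1 (reg s2 2)) != 0).
    by rewrite get ea -M3 mem_marked.
  have in4 : (x \in I3) = (arr s2 4 (arr s2 1 (reg s2 2)) != 0).
    by rewrite get ea -M4 mem_marked.
  apply: runs_if => [h3|h3].
    by apply: runs_count_hit => //; rewrite in_setU in3 h3.
  apply: runs_if => [h4|h4].
    by apply: runs_count_hit => //; rewrite in_setU in4 h4 orbT.
  apply: runs_assign; split=> //; first by case=> [|[|[|[|]]]].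
  rewrite /count_inv filter_rcons in_setU in3 in4.
  by move: h3 h4 => /= -> ->.
move=> s2 [ea e0 e1 p].
have hin2 : holds_input s2 by apply: holds_input_ext hin1.
have Ms2 : marked vs s2 = marked vs s' by rewrite /marked ea.
have r1' : reg s2 1 = index u vs by rewrite e1.
(* Common end of the two cases that add a vertex. *)
have stop s3 w : holds_input s3 -> marked vs s3 = marked vs s' -> reg s3 1 = index u vs ->
    augment e I2 I3 u (marked vs s' 5) (w |: marked vs s' 5) ->
    let s4 := set_arr s3 5 (index w vs) 1 in
    [/\ holds_input s4, reg s4 1 = reg s' 1 & augment_inv (rcons l u) (marked vs s4)].
  move=> hin3 Ms3 e3 a; split; [exact: holds_input_arr | by rewrite r1 -e3|].
  rewrite /augment_inv !marked_set_arr /= Ms3; split=> //.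
  by rewrite filter_rcons uI; apply: augment_all_rcons aug a.
have first_adj v s3 : holds_input s3 ->
  arr s3 1 (arr s3 0 (index v vs)) = index (nth v (adj v) 0) vs.
  by move=> [_ h0 _ h1]; rewrite h0 -(h1 v 0) ?addn0.
set h := [seq x <- adj u | x \in I2 :|: I3].
have uh : uniq h by rewrite filter_uniq ?uniq_adj.
have Eh : nbr e u :&: (I2 :|: I3) = [set x in h].
  by apply/setP => x; rewrite in_setI [RHS]inE mem_filter mem_adj inE andbC.
have eu v : v \in adj u -> e u v by rewrite mem_adj.
apply: (@runs_le _ _ (3 + (5 + (3 + (4 + (11 + 3) + 2)).+1)).+1) => //;
  first exact: (fun s' h => h).
apply: runs_if => [c0|c0].
  have {}c0 : reg s2 4 = 0 by apply/eqP; move: c0 => /=; case: (reg s2 4 == 0).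
  have Ew : eval s2 (Get 1 (Get 0 (Reg 1))) = index (nth u (adj u) 0) vs.
    by rewrite /= r1' first_adj.
  apply: runs_store; rewrite Ew; apply: stop => //; apply: Augment_none.
    move: p; rewrite /count_inv -/h Eh c0; case: (h) => [|x [|y h']] //; last by case.
  by rewrite inE eu // mem_nth.
have {}c0 : reg s2 4 != 0 by move: c0 => /=; case: (reg s2 4 == 0).
apply: runs_if => [c1|c1].
  have {}c1 : reg s2 4 = 1 by apply/eqP; move: c1 => /=; case: (reg s2 4 == 1).
  have [v hv rv] : exists2 v, h = [:: v] & reg s2 5 = index v vs.
    move: p; rewrite /count_inv -/h c1; by case: (h) => [|x [|y h']] //; case=> _ ->; exists x.
  have Ev : nbr e u :&: (I2 :|: I3) = [set v].
    by rewrite Eh hv; apply/setP => x; rewrite !inE.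
  have vJ : v \in I2 :|: I3.
    by have : v \in h; [rewrite hv mem_head | rewrite mem_filter => /andP[]].
  (* Entries of an adjacency list are distinct, so two of them suffice to avoid [u]. *)
  pose w := if nth v (adj v) 0 == u then nth v (adj v) 1 else nth v (adj v) 0.
  have wv : w \in nbr e v.
    by rewrite inE -mem_adj /w; case: ifP => _; rewrite mem_nth ?deg_gt1.
  have wu : w != u.
    rewrite /w; case: ifP => [/eqP<-|->//].
    by rewrite (nth_uniq v) ?deg_gt1 ?uniq_adj.
  have a := Augment_one (marked vs s' 5) Ev wv wu.
  apply: runs_assign_seq; set s3 := set_reg _ _ _.
  have hin3 : holds_input s3 by apply: holds_input_reg.
  have r6 : reg s3 6 = index (nth v (adj v) 0) vs by rewrite /= /upd /= rv (first_adj v).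
  apply: (@runs_seq _ _ _ _ _ (fun s4 => [/\ holds_input s4, marked vs s4 = marked vs s',
      reg s4 1 = index u vs & reg s4 6 = index w vs])).
    apply: (@runs_le _ _ (3 + (5 + 2)).+1) => //; first exact: (fun s' h => h).
    have cmp : (reg s3 6 == reg s3 1) = (nth v (adj v) 0 == u).
      rewrite r6 (_ : reg s3 1 = index u vs) //.
      by apply/eqP/eqP => [/index_inj|->].
    apply: runs_if => c; apply: runs_assign; split=> //.
      have -> : w = nth v (adj v) 1.
        by move: (c : nat_of_bool (reg s3 6 == reg s3 1) != 0); rewrite cmp /w; case: ifP.
      have [_ h0 _ h1] := hin2.
      by rewrite /= /upd /= rv h0 -(h1 v 1) ?deg_gt1 // addn1.
    have -> : w = nth v (adj v) 0.
      by move: (c : nat_of_bool (reg s3 6 == reg s3 1) = 0); rewrite cmp /w; case: ifP.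
    exact: r6.
  move=> s4 [hin4 Ms4 e4 e6]; apply: runs_store; rewrite (_ : eval s4 (Reg 6) = index w vs) //;
    exact: stop.
have {}c1 : reg s2 4 != 1 by move: c1 => /=; case: (reg s2 4 == 1).
apply: runs_assign; split; [exact: holds_input_reg | exact: e1 | rewrite marked_set_reg Ms2].
split=> //; rewrite filter_rcons uI; apply: augment_all_rcons aug _; apply: Augment_many.
rewrite Eh cardsE (card_uniqP uh).
by move: p; rewrite /count_inv -/h; case: (h) => [|x [|y h']] //; [move=> E;
  rewrite E in c0 | case=> E; rewrite E in c1].
Qed.

End AugmentLoop.

(** Group the ordered adjacent pairs by their underlying edge: at most two pairs have the same
    edge. *)
Lemma sum_degrees : sumn [seq size (adj v) | v <- vs] <= 2 * #|edges e|.
Proof.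
rewrite sumnE big_map (perm_big _ adj_lists.1) /= big_enum /=.
pose A := [set x : V * V | e x.1 x.2].
have -> : \sum_v size (adj v) = #|A|.
  rewrite -sum1_card (eq_bigl (fun x => predT x.1 && e x.1 x.2)); last by move=> x; rewrite inE.
  rewrite -(pair_big_dep predT (fun u v => e u v) (fun _ _ => 1)) /=.
  by apply: eq_bigr => v _; rewrite size_adj -sum1_card; apply: eq_bigl => w; rewrite inE.
rewrite -sum1_card (partition_big (fun x => [set x.1; x.2]) (mem (edges e))) /=; last first.
  by move=> x; rewrite inE => ex; apply/imsetP; exists x; rewrite ?inE.
rewrite mulnC -sum_nat_const; apply: leq_sum => _ /imsetP[[a b] /= _ ->].
rewrite sum1_card (leq_trans (_ : _ <= #|[set (a, b); (b, a)]|)) //; last first.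
  by rewrite cards2; case: (_ != _).
apply/subset_leq_card/subsetP => -[c d] /andP[]; rewrite [_ \in A]inE /= => cd /eqP/setP E;
  rewrite !inE.
have ncd : c != d by apply: contraTneq cd => ->; rewrite e_irr.
have := E c; have := E d; rewrite !inE !eqxx orbT /= => /esym Ed /esym Ec.
rewrite !xpair_eqE.
case/orP: Ec => /eqP Ec; case/orP: Ed => /eqP Ed; subst; rewrite ?eqxx ?orbT // in ncd *.
Qed.

Lemma runs_program : (exists D : {set V}, liars_dominating e D) ->
  runs program (input_state vs adj) (600 * (#|V| + #|edges e|).+1)
    (fun s => algorithm_run e (marked vs s 2) (marked vs s 3) (marked vs s 4) (marked vs s 5)).
Proof.
move=> [D0 [lds1 lds2]].
have deg0 v : 0 < size (adj v).
  rewrite size_adj; have := lds1 v; apply: contraTT; rewrite -leqNgt leqn0 cards_eq0 => /eqP E.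
  by rewrite -ltnNge ltnS /cnbr E setU0 (leq_trans (subset_leq_card (subsetIl _ _))) ?cards1.
pose X1 := [set v | size (adj v) == 1].
(* Two adjacent vertices of degree 1 have only each other as neighbours, so their closed
   neighbourhoods together have two elements where three are required. *)
have X1_far v w : v \in X1 -> w \in X1 -> ~~ e v w.
  rewrite !inE !size_adj => /cards1P[v' Ev] /cards1P[w' Ew]; apply/negP => vw.
  have nvw : v != w by apply: contraTneq vw => ->; rewrite e_irr.
  have Ev' : nbr e v = [set w].
    by have : w \in nbr e v; [rewrite inE | rewrite Ev in_set1 => /eqP->].
  have Ew' : nbr e w = [set v].
    by have : v \in nbr e w; [rewrite inE e_sym | rewrite Ew in_set1 => /eqP->].
  have := lds2 v w nvw; rewrite /cnbr Ev' Ew' leqNgt => /negP[]; rewrite ltnS.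
  rewrite [w |: _]setUC setUid (leq_trans (subset_leq_card (subsetIl _ _))) //.
  by rewrite cards2; case: (_ != _).
pose d := sumn [seq size (adj v) | v <- vs].
have sz : size vs = #|V| by rewrite (perm_size adj_lists.1) -cardE.
pose T := size vs * 50 + 20 * d + 6.
(* The total is [258 * size vs + 119 * d + 30], and [d] is at most twice the number of edges. *)
apply: (@runs_le _ _ (T + (T + (T + (T + (size vs * 58 + 39 * d + 6))))));
  [by rewrite /T sz; have := sum_degrees; rewrite -/d; lia | exact: (fun s' h => h) |].
have hin := holds_input_state.
have M0 a : 1 < a -> marked vs (input_state vs adj) a = set0.
  by case: a => [|[|a]] // _; apply/setP => v; rewrite mem_marked inE.
have ind0 : independent e set0 by apply/independentP => u v; rewrite in_set0.
have unsel (Y : {set V}) s' v : holds_input s' -> reg s' 1 = index v vs ->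
    (v \in marked vs s' 5) = (v \in Y) -> (eval s' unselected_cond != 0) = (v \in ~: Y).
  by move=> _ r1; rewrite in_setC => <-; rewrite mem_marked /= r1;
    case: (arr s' 5 (index v vs) == 0).
apply: runs_seq; first apply: (@runs_greedy 2 _ X1) => //; rewrite ?M0 ?sub0set //.
  move=> s' v [_ h0 h1 _] r1 _; rewrite /= r1 h0 h1 inE -[(off v).+1]addn1 eqn_add2l.
  by case: (size (adj v) == 1).
move=> s1 [hin1 [[D1 o1 i1] [_ mem1 dom1]]].
rewrite M0 // set0U in D1.
(* Vertices of degree 1 are pairwise nonadjacent, so the first pass rejects none. *)
have X1E : X1 = marked vs s1 2.
  apply/setP => v; apply/idP/idP => [vX|/mem1[|[]]]; rewrite ?M0 ?in_set0 //.
  apply: contraT => nv; have [w wM vw] := dom1 v (mem_vs v) vX nv.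
  have [|[wX _]] := mem1 w wM; first by rewrite M0 ?in_set0.
  by have := X1_far v w vX wX; rewrite vw.
(* The second pass extends the same array 2, and the result is maximal among all vertices. *)
apply: runs_seq; first apply: (@runs_greedy 2 _ (~: marked vs s1 5)) => //; rewrite ?D1 //.
  by move=> s' v ? ?; rewrite -D1; apply: unsel.
move=> s2 [hin2 [[D2 o2 i2] [sub2 mem2 dom2]]].
rewrite D1 (setUidPr sub2) in D2.
have E2 a : 2 < a -> a != 5 -> marked vs s2 a = set0.
  move=> a2 a5; have a2' : a != 2 by apply: contraTneq a2 => ->.
  by rewrite o2 // o1 // M0 // ltnW.
have E23 : marked vs s2 3 = set0 by rewrite E2.
have run1 : select_round e setT (marked vs s2 2).
  apply/select_roundP => //; split=> // v _ nv.
  by apply: dom2; rewrite ?mem_vs // in_setC; apply: contra nv; apply: (subsetP sub2).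
apply: runs_seq; first apply: (@runs_greedy 3 _ (~: marked vs s2 5)) => //;
  rewrite ?E23 ?sub0set //.
  by move=> s' v ? ?; apply: unsel.
move=> s3 [hin3 [[D3 o3 i3] [_ mem3 dom3]]].
rewrite D2 in D3 mem3 dom3.
have run2 : select_round e (setT :\: marked vs s2 2) (marked vs s3 3).
  apply/select_roundP => //; rewrite setTD; split=> // [|v vX]; last exact: dom3 (mem_vs v) vX.
  by apply/subsetP => v /mem3[|[]]; rewrite ?E23 ?in_set0.
have E3 : marked vs s3 4 = set0 by rewrite o3 ?E2.
apply: runs_seq; first apply: (@runs_greedy 4 _ (~: marked vs s3 5)) => //; rewrite ?E3 ?sub0set //.
  by move=> s' v ? ?; apply: unsel.
move=> s4 [hin4 [[D4 o4 i4] [_ mem4 dom4]]].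
rewrite D3 in D4 mem4 dom4.
have run3 : select_round e (setT :\: marked vs s2 2 :\: marked vs s3 3) (marked vs s4 4).
  apply/select_roundP => //; rewrite setTD setDE -setCU; split=> // [|v vX];
    last exact: dom4 (mem_vs v) vX.
  by apply/subsetP => v /mem4[|[]]; rewrite ?E3 ?in_set0.
have F2 : marked vs s4 2 = marked vs s2 2 by rewrite o4 // o3.
have F3 : marked vs s4 3 = marked vs s3 3 by rewrite o4.
set I1 := marked vs s2 2 in run1 run2 run3 sub2 D4 F2 *.
set I2 := marked vs s3 3 in run2 run3 D4 F3 *; set I3 := marked vs s4 4 in run3 D4 *.
apply: runs_le (leqnn _) _ (@runs_augment_loop I1 I2 I3 (I1 :|: I2 :|: I3) deg0 _ s4 hin4 _).
- move=> s [_ [-> -> -> aug]]; split=> //.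
  exists [seq v <- vs | v \in I1] => //.
  by rewrite /enum_mem -enumT; apply: perm_filter; rewrite adj_lists.1.
(* A vertex of degree 1 is in [I1], hence in neither [I2] nor [I3]. *)
- move=> v vJ; rewrite ltn_neqAle eq_sym deg0 andbT; apply/negP => v1.
  have vI1 : v \in I1 by apply: (subsetP sub2); rewrite -X1E inE.
  have [s2' _ _] := (select_roundP e_irr e_sym _ _).1 run2.
  have [s3' _ _] := (select_roundP e_irr e_sym _ _).1 run3.
  case/setUP: vJ => [/(subsetP s2')|/(subsetP s3')]; by rewrite !in_setD vI1 ?andbF.
by split; rewrite ?F2 ?F3 //= D4.
Qed.

End Program.

Theorem theorem2 (R : realType) :
  (forall (V : finType) (e : rel V),
     unit_disk_graph R e ->
     (exists D : {set V}, liars_dominating e D) ->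
     forall I1 I2 I3 D : {set V}, algorithm_run e I1 I2 I3 D ->
       liars_dominating e D /\
       forall Dstar : {set V}, minimum_liars_dominating e Dstar ->
         (#|D|%:R <= 731%:R / 100%:R * #|Dstar|%:R :> R)%R) /\
  (exists (c : cmd) (C : nat), forall (V : finType) (e : rel V),
     unit_disk_graph R e ->
     (exists D : {set V}, liars_dominating e D) ->
     implements_within e c (C * (#|V| + #|edges e|).+1)).
Proof.
split=> [V e ud _ I1 I2 I3 D run|].
  have [pos udg] := ud; split=> [|Dstar [lds _]]; last exact: algorithm_run_ratio run lds.
  exact (algorithm_run_correct (udg_irr udg) (udg_sym udg) run).
exists program, 600 => V e [pos udg] lds vs adj lists.
exact: runs_program (udg_irr udg) (udg_sym udg) lists lds.
Qed.
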